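(* Let $f:(0,\infty)\to(0,\infty)$ be a continuous function which satisfies $$\liminf_{s\to\infty}\frac{f(s)}{s^{-1}\log s}>0.$$ Then the inequality $$-\Delta^2 v\ge f(v)$$ has no $C^4$ positive solution $v$ in any exterior domain of $\mathbb{R}^2$.
   Context: $\Delta^2=\Delta\circ\Delta$ is the biharmonic operator. An exterior domain of $\mathbb{R}^2$ is the complement $\mathbb{R}^2\setminus K$ of a compact set $K\subset\mathbb{R}^2$. A $C^4$ positive solution is a $C^4$ function $v>0$ satisfying the inequality pointwise. *)

(* Defs.v *)
From Stdlib Require Import Reals List.
From Coquelicot Require Import Coquelicot.
Open Scope R_scope.

(* Stdlib's [compact] is only for subsets of [R]. *)
Definition compact_set {T : UniformSpace} (K : T -> Prop) : Prop :=
  forall (I : Type) (U : I -> T -> Prop),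
    (forall i, open (U i)) ->
    (forall x, K x -> exists i, U i x) ->
    exists l : list I, forall x, K x -> exists i, In i l /\ U i x.

Definition exterior_domain (Omega : R * R -> Prop) : Prop :=
  exists K : R * R -> Prop,
    compact_set K /\ forall p, Omega p <-> ~ K p.

(* sup over M of the infimum of g on (M, +oo), in [Rbar]; values of g on any
   half-line (-oo, a] do not matter. *)
Definition LimInf_p_infty (g : R -> R) : Rbar :=
  Rbar_lub (fun L => exists M : R,
    L = Glb_Rbar (fun y => exists s : R, M < s /\ y = g s)).

(* Functions on an open subset Omega of the plane are total functions
   [R -> R -> R] whose values outside Omega are irrelevant: the derivatives
   below at a point of Omega only depend on the function near that point. *)

(* [ex_diff_n v n x y]: all iterated partial derivatives of v of order at most n
   exist and are continuous at (x, y). *)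
Definition C_n_on (n : nat) (Omega : R * R -> Prop) (v : R -> R -> R) : Prop :=
  forall x y, Omega (x, y) -> ex_diff_n v n x y.

Definition laplacian (v : R -> R -> R) (x y : R) : R :=
  partial_derive 2 0 v x y + partial_derive 0 2 v x y.

Definition bilaplacian (v : R -> R -> R) : R -> R -> R :=
  laplacian (laplacian v).

Definition C4_positive_solution (f : R -> R) (Omega : R * R -> Prop)
    (v : R -> R -> R) : Prop :=
  C_n_on 4 Omega v /\
  (forall x y, Omega (x, y) -> 0 < v x y) /\
  (forall x y, Omega (x, y) -> - bilaplacian v x y >= f (v x y)).

(* Main.v *)
Require Import Defs.
From Stdlib Require Import Reals Lra Psatz List Classical.
From Coquelicot Require Import Coquelicot.
Open Scope R_scope.
Set Bullet Behavior "Strict Subproofs".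

(** Let [u], [z] be the integrals of [v] and [Lap v] over the circle of radius
    [r] around the origin.  Since [(r z')' < 0], positivity of [u] forces
    [r z' >= 0], and then either [c r^2 <= u <= C r^2 ln r] or
    [c <= u <= C ln r] for large [r].

    On a disc where [v >= 0] and [Lap Lap v <= 0], the circular mean of [v] is a
    concave function of the squared radius, so the value at the centre is at
    most 4/3 of the mean over any circle of at most half the radius.  Averaging
    over such circles bounds [v (x)], [|x| = r], by a multiple of the maximum of
    [u] over [[r/2, 3r/2]]; call the resulting bound [S (r)].

    Finally [f (s) >= c (ln S / S) (s - eps) / S] for [0 < s <= S], which is
    linear in [s] and can be averaged over circles.  With the bounds on [u] and
    [S] it gives [(r z')' <= - k / (r ln r)], so [r z'] tends to [-oo]. *)

(** * Circular means and fluxes *)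

(** The mean of [f v] cannot be bounded below through the mean of [v] alone: [f] need be neither
    monotone nor convex, and a bound of order [ln s / s] is weakest where [v] is large, so [v] could
    concentrate on a short arc. This is why a pointwise upper bound [S] is needed. The shift by
    [eps] is needed because [f] may tend to 0 at 0; [eps] is so small that the lower bound of [u]
    still dominates it. Write [A = r ^ 2] or [A = 1] for the two growth rates, so that [u >= c A]
    and [S] is a multiple of [A ln r]. The slope of the linear bound is of order [ln S / S ^ 2],
    hence the right-hand side of the equation for [(r z')'] is of size [r ln S / (A (ln r) ^ 2)].
    For [A = 1] this is far more than required. For [A = r ^ 2], [ln S] is at least [ln r] and what
    remains is exactly [1 / (r ln r)], whose primitive [ln (ln r)] still diverges: this is the
    critical case, and it consumes the logarithm in the hypothesis on [f]. *)

Definition open_2d (U : R -> R -> Prop) : Prop :=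
  forall x y, U x y -> locally_2d U x y.

(** The partial derivatives are carried as explicit functions, so that sums and cutoffs come with
    formulas for their gradients. *)
Definition grad_on (U : R -> R -> Prop) (g gx gy : R -> R -> R) : Prop :=
  forall x y, U x y ->
    is_derive (fun t => g t y) x (gx x y) /\
    is_derive (fun t => g x t) y (gy x y) /\
    continuity_2d_pt gx x y /\ continuity_2d_pt gy x y.

(** Not divided by [2 * PI]. Zero and negative radii are allowed, which makes the centre an interior
    point when differentiating in [s]. *)
Definition mean (g : R -> R -> R) (x0 y0 s : R) : R :=
  RInt (fun t => g (x0 + s * cos t) (y0 + s * sin t)) 0 (2 * PI).

(** For [s > 0], [s * flux X Y x0 y0 s] is the outward flux of the field [(X, Y)] through the circle
    of radius [s]. *)
Definition flux (X Y : R -> R -> R) (x0 y0 s : R) : R :=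
  RInt (fun t => cos t * X (x0 + s * cos t) (y0 + s * sin t)
               + sin t * Y (x0 + s * cos t) (y0 + s * sin t)) 0 (2 * PI).

Lemma grad_on_differentiable U g gx gy x y :
  open_2d U -> grad_on U g gx gy -> U x y ->
  differentiable_pt_lim g x y (gx x y) (gy x y).
Proof.
  intros HU Hg Hxy.
  apply filterdiff_differentiable_pt_lim.
  apply (is_derive_filterdiff g x y gx (gy x y)).
  - destruct (HU x y Hxy) as [d Hd].
    exists d; intros [u w] [Hu Hw].
    exact (proj1 (Hg u w (Hd u w Hu Hw))).
  - exact (proj1 (proj2 (Hg x y Hxy))).
  - apply (proj1 (continuity_2d_pt_filterlim gx x y)), (Hg x y Hxy).
Qed.

Lemma grad_on_continuity U g gx gy x y :
  open_2d U -> grad_on U g gx gy -> U x y -> continuity_2d_pt g x y.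
Proof.
  intros HU Hg Hxy.
  apply differentiable_continuity_pt.
  exists (gx x y), (gy x y).
  now apply (grad_on_differentiable U).
Qed.

Lemma grad_on_comp U g gx gy (p q : R -> R) (t p' q' : R) :
  open_2d U -> grad_on U g gx gy -> U (p t) (q t) ->
  is_derive p t p' -> is_derive q t q' ->
  is_derive (fun t => g (p t) (q t)) t
    (gx (p t) (q t) * p' + gy (p t) (q t) * q').
Proof.
  intros HU Hg Hpq Hp Hq.
  apply is_derive_Reals, derivable_pt_lim_comp_2d.
  - now apply (grad_on_differentiable U).
  - now apply is_derive_Reals.
  - now apply is_derive_Reals.
Qed.

Lemma continuity_2d_pt_comp (f p q : R -> R -> R) (x y : R) :
  continuity_2d_pt f (p x y) (q x y) ->
  continuity_2d_pt p x y -> continuity_2d_pt q x y ->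
  continuity_2d_pt (fun u v => f (p u v) (q u v)) x y.
Proof.
  intros Hf Hp Hq.
  apply continuity_2d_pt_filterlim.
  apply (continuous_comp_2 (fun z : R * R => p (fst z) (snd z))
           (fun z => q (fst z) (snd z)) f (x, y)).
  - now apply continuity_2d_pt_filterlim.
  - now apply continuity_2d_pt_filterlim.
  - now apply (continuity_2d_pt_filterlim f).
Qed.

Lemma continuity_2d_pt_snd (f : R -> R -> R) (x y : R) :
  continuity_2d_pt f x y -> continuous (f x) y.
Proof.
  intros Hf.
  apply (continuous_comp_2 (fun _ => x) (fun t => t) f y).
  - apply continuous_const.
  - apply continuous_id.
  - now apply (continuity_2d_pt_filterlim f).
Qed.

Lemma continuity_2d_polar (g : R -> R -> R) (x0 y0 s t : R) :
  continuity_2d_pt g (x0 + s * cos t) (y0 + s * sin t) ->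
  continuity_2d_pt (fun s t => g (x0 + s * cos t) (y0 + s * sin t)) s t.
Proof.
  intros Hg.
  apply (continuity_2d_pt_comp g (fun s t => x0 + s * cos t)
           (fun s t => y0 + s * sin t)).
  - exact Hg.
  - apply continuity_2d_pt_plus; [apply continuity_2d_pt_const|].
    apply continuity_2d_pt_mult; [apply continuity_2d_pt_id1|].
    apply (continuity_1d_2d_pt_comp cos (fun _ t => t));
      [apply continuity_cos|apply continuity_2d_pt_id2].
  - apply continuity_2d_pt_plus; [apply continuity_2d_pt_const|].
    apply continuity_2d_pt_mult; [apply continuity_2d_pt_id1|].
    apply (continuity_1d_2d_pt_comp sin (fun _ t => t));
      [apply continuity_sin|apply continuity_2d_pt_id2].
Qed.

Lemma ex_RInt_polar (g : R -> R -> R) (x0 y0 s a b : R) :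
  (forall t, continuity_2d_pt g (x0 + s * cos t) (y0 + s * sin t)) ->
  ex_RInt (fun t => g (x0 + s * cos t) (y0 + s * sin t)) a b.
Proof.
  intros Hg.
  apply (ex_RInt_continuous (V := R_CompleteNormedModule)); intros t _.
  apply (continuity_2d_pt_snd (fun s t => g (x0 + s * cos t) (y0 + s * sin t))).
  now apply continuity_2d_polar.
Qed.

Lemma locally_open_interval (s1 s2 s : R) :
  s1 < s < s2 -> locally s (fun u => s1 < u < s2).
Proof.
  intros Hs.
  apply filter_and.
  - now apply (open_gt s1).
  - now apply (open_lt s2).
Qed.

Lemma is_derive_RInt_param_interval (k dk : R -> R -> R) (s1 s2 a b s : R) :
  s1 < s < s2 ->
  (forall u t, s1 < u < s2 -> is_derive (fun u => k u t) u (dk u t)) ->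
  (forall u t, s1 < u < s2 -> continuity_2d_pt dk u t) ->
  (forall u, s1 < u < s2 -> ex_RInt (k u) a b) ->
  is_derive (fun u => RInt (k u) a b) s (RInt (dk s) a b).
Proof.
  intros Hs Hk Hdk Hint.
  pose proof (locally_open_interval s1 s2 s Hs) as Hloc.
  rewrite <- (RInt_ext (fun t => Derive (fun u => k u t) s)).
  2: { intros t _. now apply is_derive_unique, Hk. }
  apply is_derive_RInt_param.
  - apply (filter_imp (fun u => s1 < u < s2)); [|exact Hloc].
    intros u Hu t _. exists (dk u t). now apply Hk.
  - intros t _.
    apply continuity_2d_pt_ext_loc with (f := dk); [|now apply Hdk].
    destruct Hloc as [d Hd]. exists d; intros u w Hu Hw.
    symmetry; apply is_derive_unique, Hk, Hd, Hu.
  - apply (filter_imp (fun u => s1 < u < s2)); [|exact Hloc].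
    exact Hint.
Qed.

Lemma is_derive_circle_radius U g gx gy x0 y0 s t :
  open_2d U -> grad_on U g gx gy -> U (x0 + s * cos t) (y0 + s * sin t) ->
  is_derive (fun s => g (x0 + s * cos t) (y0 + s * sin t)) s
    (gx (x0 + s * cos t) (y0 + s * sin t) * cos t
     + gy (x0 + s * cos t) (y0 + s * sin t) * sin t).
Proof.
  intros HU Hg HUt.
  apply (grad_on_comp U g gx gy (fun s => x0 + s * cos t)
           (fun s => y0 + s * sin t)); try assumption.
  - auto_derive; [exact I|ring].
  - auto_derive; [exact I|ring].
Qed.

Lemma is_derive_circle_angle U g gx gy x0 y0 s t :
  open_2d U -> grad_on U g gx gy -> U (x0 + s * cos t) (y0 + s * sin t) ->
  is_derive (fun t => g (x0 + s * cos t) (y0 + s * sin t)) t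
    (gx (x0 + s * cos t) (y0 + s * sin t) * (- s * sin t)
     + gy (x0 + s * cos t) (y0 + s * sin t) * (s * cos t)).
Proof.
  intros HU Hg HUt.
  apply (grad_on_comp U g gx gy (fun t => x0 + s * cos t)
           (fun t => y0 + s * sin t)); try assumption.
  - auto_derive; [exact I|ring].
  - auto_derive; [exact I|ring].
Qed.

Ltac cont2d_step :=
  first
    [ apply continuity_2d_pt_plus | apply continuity_2d_pt_mult
    | apply continuity_2d_pt_opp
    | apply continuity_2d_pt_const | apply continuity_2d_pt_id1
    | apply continuity_2d_pt_id2
    | apply (continuity_1d_2d_pt_comp cos (fun _ t => t)); [apply continuity_cos|]
    | apply (continuity_1d_2d_pt_comp sin (fun _ t => t)); [apply continuity_sin|] ].

Ltac cont2d := repeat cont2d_step.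

Lemma is_derive_mean U g gx gy x0 y0 s1 s2 s :
  open_2d U -> grad_on U g gx gy ->
  (forall u t, s1 < u < s2 -> U (x0 + u * cos t) (y0 + u * sin t)) ->
  s1 < s < s2 ->
  is_derive (mean g x0 y0) s (flux gx gy x0 y0 s).
Proof.
  intros HU Hg Hc Hs.
  apply (is_derive_RInt_param_interval
    (fun s t => g (x0 + s * cos t) (y0 + s * sin t))
    (fun s t => cos t * gx (x0 + s * cos t) (y0 + s * sin t)
              + sin t * gy (x0 + s * cos t) (y0 + s * sin t)) s1 s2).
  - exact Hs.
  - intros u t Hu.
    rewrite (Rmult_comm (cos t)), (Rmult_comm (sin t)).
    now apply (is_derive_circle_radius U); auto.
  - intros u t Hu.
    destruct (Hg _ _ (Hc u t Hu)) as (_ & _ & Cx & Cy).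
    cont2d; now apply continuity_2d_polar.
  - intros u Hu. apply ex_RInt_polar; intros t.
    apply (grad_on_continuity U g gx gy); auto.
Qed.

(* The terms not containing [X_x + Y_y] in the radial derivative form the
   angular derivative of the periodic function [sin * X - cos * Y]. *)
Lemma is_derive_radius_flux U X Xx Xy Y Yx Yy x0 y0 s1 s2 s :
  open_2d U -> grad_on U X Xx Xy -> grad_on U Y Yx Yy ->
  (forall u t, s1 < u < s2 -> U (x0 + u * cos t) (y0 + u * sin t)) ->
  s1 < s < s2 ->
  is_derive (fun s => s * flux X Y x0 y0 s) s
    (s * mean (fun x y => Xx x y + Yy x y) x0 y0 s).
Proof.
  intros HU HX HY Hc Hs.
  assert (Hcont : forall u t, s1 < u < s2 ->
    continuity_2d_pt X (x0 + u * cos t) (y0 + u * sin t) /\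
    continuity_2d_pt Y (x0 + u * cos t) (y0 + u * sin t)).
  { intros u t Hu; split.
    - apply (grad_on_continuity U X Xx Xy); auto.
    - apply (grad_on_continuity U Y Yx Yy); auto. }
  assert (Hflux : forall u, s1 < u < s2 -> ex_RInt
    (fun t => cos t * X (x0 + u * cos t) (y0 + u * sin t)
            + sin t * Y (x0 + u * cos t) (y0 + u * sin t)) 0 (2 * PI)).
  { intros u Hu. apply (ex_RInt_continuous (V := R_CompleteNormedModule)).
    intros t _.
    apply (continuity_2d_pt_snd (fun u t =>
       cos t * X (x0 + u * cos t) (y0 + u * sin t)
     + sin t * Y (x0 + u * cos t) (y0 + u * sin t))).
    destruct (Hcont u t Hu).
    cont2d; now apply continuity_2d_polar. }
  set (dk := fun u t =>
     (cos t * X (x0 + u * cos t) (y0 + u * sin t)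
       + sin t * Y (x0 + u * cos t) (y0 + u * sin t))
     + u * (cos t * (Xx (x0 + u * cos t) (y0 + u * sin t) * cos t
                     + Xy (x0 + u * cos t) (y0 + u * sin t) * sin t)
            + sin t * (Yx (x0 + u * cos t) (y0 + u * sin t) * cos t
                     + Yy (x0 + u * cos t) (y0 + u * sin t) * sin t))).
  set (j := fun t => sin t * X (x0 + s * cos t) (y0 + s * sin t)
                   - cos t * Y (x0 + s * cos t) (y0 + s * sin t)).
  set (dj := fun t => dk s t
     - s * (Xx (x0 + s * cos t) (y0 + s * sin t)
            + Yy (x0 + s * cos t) (y0 + s * sin t))).
  assert (Cdk : forall u t, s1 < u < s2 -> continuity_2d_pt dk u t).
  { intros u t Hu. unfold dk.
    destruct (Hcont u t Hu).
    destruct (HX _ _ (Hc u t Hu)) as (_ & _ & ? & ?).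
    destruct (HY _ _ (Hc u t Hu)) as (_ & _ & ? & ?).
    cont2d; now apply continuity_2d_polar. }
  assert (Cdiv : forall t, continuous (fun t => s * (Xx (x0 + s * cos t) (y0 + s * sin t)
            + Yy (x0 + s * cos t) (y0 + s * sin t))) t).
  { intros t.
    destruct (HX _ _ (Hc s t Hs)) as (_ & _ & ? & ?).
    destruct (HY _ _ (Hc s t Hs)) as (_ & _ & ? & ?).
    apply (continuity_2d_pt_snd (fun s t => s * (Xx (x0 + s * cos t) (y0 + s * sin t)
            + Yy (x0 + s * cos t) (y0 + s * sin t)))).
    cont2d; now apply continuity_2d_polar. }
  assert (Hdj : is_RInt dj 0 (2 * PI) 0).
  { replace 0 with (minus (j (2 * PI)) (j 0)) at 2.
    2: { unfold j, minus, plus, opp; simpl.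
         rewrite sin_2PI, cos_2PI, sin_0, cos_0; ring. }
    apply (is_RInt_derive (V := R_CompleteNormedModule) j dj).
    - intros t _.
      pose proof (is_derive_circle_angle U X Xx Xy x0 y0 s t HU HX (Hc s t Hs)) as DX.
      pose proof (is_derive_circle_angle U Y Yx Yy x0 y0 s t HU HY (Hc s t Hs)) as DY.
      unfold j.
      set (P := fun t => X (x0 + s * cos t) (y0 + s * sin t)) in *.
      set (Q := fun t => Y (x0 + s * cos t) (y0 + s * sin t)) in *.
      apply (is_derive_ext (fun t => sin t * P t - cos t * Q t)); [reflexivity|].
      auto_derive.
      + split; [now exists (Xx (x0 + s * cos t) (y0 + s * sin t) * (- s * sin t)
             + Xy (x0 + s * cos t) (y0 + s * sin t) * (s * cos t))|].
        split; [|exact I].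
        now exists (Yx (x0 + s * cos t) (y0 + s * sin t) * (- s * sin t)
             + Yy (x0 + s * cos t) (y0 + s * sin t) * (s * cos t)).
      + rewrite (is_derive_unique (fun x : R => P x) _ _ DX).
        rewrite (is_derive_unique (fun x : R => Q x) _ _ DY).
        unfold dj, dk, P, Q.
        set (xx := Xx _ _). set (yy := Yy _ _).
        (* The factor [sin ^ 2 + cos ^ 2] makes both sides homogeneous in [sin t] and [cos t], so
           that [ring] suffices. *)
        replace (s * (xx + yy)) with (s * (xx + yy) * (Rsqr (sin t) + Rsqr (cos t)))
          by (rewrite sin2_cos2; ring).
        unfold Rsqr; ring.
    - intros t _. unfold dj.
      apply (continuous_minus (V := R_NormedModule)).
      + now apply continuity_2d_pt_snd, Cdk.
      + apply Cdiv. }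
  apply (is_derive_ext_loc (fun u => RInt (fun t => u *
     (cos t * X (x0 + u * cos t) (y0 + u * sin t)
            + sin t * Y (x0 + u * cos t) (y0 + u * sin t))) 0 (2 * PI))).
  { apply (filter_imp (fun u => s1 < u < s2)); [|now apply locally_open_interval].
    intros u Hu. apply (RInt_scal (V := R_CompleteNormedModule)). now apply Hflux. }
  replace (s * mean (fun x y => Xx x y + Yy x y) x0 y0 s) with (RInt (dk s) 0 (2 * PI)).
  2: { rewrite (RInt_ext _ (fun t => plus (dj t) (s * (Xx (x0 + s * cos t) (y0 + s * sin t)
            + Yy (x0 + s * cos t) (y0 + s * sin t))))).
       2: { intros t _. unfold dj, plus; simpl; ring. }
       rewrite (RInt_plus (V := R_CompleteNormedModule)).
       - rewrite (is_RInt_unique _ _ _ _ Hdj). unfold plus; simpl.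
         rewrite Rplus_0_l. apply (RInt_scal (V := R_CompleteNormedModule)).
         apply (ex_RInt_polar (fun x y => Xx x y + Yy x y)); intros t.
         destruct (HX _ _ (Hc s t Hs)) as (_ & _ & ? & ?).
         destruct (HY _ _ (Hc s t Hs)) as (_ & _ & ? & ?).
         now apply continuity_2d_pt_plus.
       - now exists 0.
       - apply (ex_RInt_continuous (V := R_CompleteNormedModule)); auto. }
  apply (is_derive_RInt_param_interval _ dk s1 s2); auto.
  - intros u t Hu.
    pose proof (is_derive_circle_radius U X Xx Xy x0 y0 u t HU HX (Hc u t Hu)) as DX.
    pose proof (is_derive_circle_radius U Y Yx Yy x0 y0 u t HU HY (Hc u t Hu)) as DY.
    set (P := fun u => X (x0 + u * cos t) (y0 + u * sin t)) in *.
    set (Q := fun u => Y (x0 + u * cos t) (y0 + u * sin t)) in *.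
    apply (is_derive_ext (fun u => u * (cos t * P u + sin t * Q u))); [reflexivity|].
    auto_derive.
    + split; [eexists; exact DX|]. split; [eexists; exact DY|exact I].
    + rewrite (is_derive_unique (fun x : R => P x) _ _ DX).
      rewrite (is_derive_unique (fun x : R => Q x) _ _ DY).
      unfold dk, P, Q. ring.
  - intros u Hu. apply (ex_RInt_scal (V := R_NormedModule)), Hflux, Hu.
Qed.

(** * Radial functions and cutoffs *)

Lemma nondecreasing_of_derive (f df : R -> R) (a b : R) :
  a <= b ->
  (forall x, a <= x <= b -> is_derive f x (df x)) ->
  (forall x, a < x < b -> 0 <= df x) -> f a <= f b.
Proof.
  intros Hab Hf Hdf.
  destruct (Rle_lt_or_eq_dec a b Hab) as [Hlt|<-]; [|lra].
  destruct (MVT_cor2 f df a b Hlt) as (c & Hc & Hcab).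
  - intros c Hc. now apply is_derive_Reals, Hf.
  - assert (0 <= df c * (b - a)) by (apply Rmult_le_pos; [now apply Hdf|lra]). lra.
Qed.

Lemma nonincreasing_of_derive (f df : R -> R) (a b : R) :
  a <= b ->
  (forall x, a <= x <= b -> is_derive f x (df x)) ->
  (forall x, a < x < b -> df x <= 0) -> f b <= f a.
Proof.
  intros Hab Hf Hdf.
  apply Ropp_le_cancel.
  apply (nondecreasing_of_derive (fun x => - f x) (fun x => - df x)); auto.
  - intros x Hx. now apply (is_derive_opp f), Hf.
  - intros x Hx. specialize (Hdf x Hx). lra.
Qed.

(* [phi] is a concave function of [s ^ 2]: this is the radial form of
   [Lap Lap <= 0] on a disc. *)
Lemma radial_center_le (phi phi1 m m1 h : R -> R) (rho rho' s : R) :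
  (forall s, - rho' < s < rho' -> is_derive phi s (phi1 s)) ->
  (forall s, - rho' < s < rho' -> is_derive (fun s => s * phi1 s) s (s * m s)) ->
  (forall s, - rho' < s < rho' -> is_derive m s (m1 s)) ->
  (forall s, - rho' < s < rho' -> is_derive (fun s => s * m1 s) s (s * h s)) ->
  (forall s, - rho' < s < rho' -> h s <= 0) ->
  rho < rho' -> 0 <= phi rho -> 0 < s <= rho / 2 -> 0 <= phi s -> phi 0 <= 4 / 3 * phi s.
Proof.
  intros H1 H2 H3 H4 Hh Hrho Hphi Hs Hphis.
  assert (A1 : forall t, 0 <= t < rho' -> t * m1 t <= 0).
  { intros t Ht. rewrite <- (Rmult_0_l (m1 0)).
    apply (nonincreasing_of_derive (fun s => s * m1 s) (fun s => s * h s)).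
    - lra.
    - intros; apply H4; lra.
    - intros x Hx. assert (h x <= 0) by (apply Hh; lra). nra. }
  (* [t * phi1 t] is the integral of [s * m s] over [[0, t]], and [m] is nonincreasing by [A1]. This
     inequality is the sign condition for the derivative of [phi1 x / x] in [A3]. *)
  assert (A2 : forall t, 0 <= t < rho' -> t ^ 2 * m t / 2 <= t * phi1 t).
  { intros t Ht.
    cut (0 * phi1 0 - 0 ^ 2 * m 0 / 2 <= t * phi1 t - t ^ 2 * m t / 2); [simpl; lra|].
    apply (nondecreasing_of_derive (fun t => t * phi1 t - t ^ 2 * m t / 2)
             (fun t => - (t * (t * m1 t)) / 2)).
    - lra.
    - intros x Hx.
      replace (- (x * (x * m1 x)) / 2)
        with (minus (x * m x) (x * m x + x ^ 2 * m1 x / 2)).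
      2: { unfold minus, plus, opp; simpl; lra. }
      apply (is_derive_minus (fun x => x * phi1 x) (fun x => x ^ 2 * m x / 2)); [apply H2; lra|].
      assert (D : is_derive m x (m1 x)) by (apply H3; lra).
      auto_derive; [eexists; exact D|].
      rewrite (is_derive_unique (fun x : R => m x) _ _ D). simpl; lra.
    - intros x Hx. assert (x * m1 x <= 0) by (apply A1; lra). nra. }
  assert (A3 : forall t u, 0 < t -> t <= u -> u < rho' -> phi1 u / u <= phi1 t / t).
  { intros t u Ht Htu Hu.
    assert (B : forall x, 0 < x -> phi1 x / x = x * phi1 x / x ^ 2)
      by (intros; field; lra).
    rewrite !B by lra.
    apply (nonincreasing_of_derive (fun x => x * phi1 x / x ^ 2)
      (fun x => 2 * (x ^ 2 * m x / 2 - x * phi1 x) / x ^ 3)); auto.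
    - intros x Hx.
      assert (D : is_derive (fun s => s * phi1 s) x (x * m x)) by (apply H2; lra).
      set (N := fun s => s * phi1 s) in *.
      apply (is_derive_ext (fun x => N x / x ^ 2)); [reflexivity|].
      auto_derive.
      + split; [eexists; exact D|]. split; [|exact I]. nra.
      + rewrite (is_derive_unique (fun x : R => N x) _ _ D).
        unfold N. field. lra.
    - intros x Hx. assert (x ^ 2 * m x / 2 <= x * phi1 x) by (apply A2; lra).
      assert (0 < / x ^ 3) by (apply Rinv_0_lt_compat, pow_lt; lra).
      unfold Rdiv at 1. nra. }
  (* [K / 2] is the derivative of [phi] with respect to the squared radius at [s]. [L1] and [L2] say
     that [phi] lies below its tangent there, at the radii 0 and [rho]. *)
  set (K := phi1 s / s).
  assert (HD : forall x, - rho' < x < rho' ->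
    is_derive (fun x => phi x - K * x ^ 2 / 2) x (phi1 x - K * x)).
  { intros x Hx. pose proof (H1 x Hx) as D.
    auto_derive; [eexists; exact D|].
    rewrite (is_derive_unique (fun x : R => phi x) _ _ D). lra. }
  assert (E : forall x, 0 < x -> phi1 x = phi1 x / x * x) by (intros; field; lra).
  assert (L1 : phi 0 - K * 0 ^ 2 / 2 <= phi s - K * s ^ 2 / 2).
  { apply (nondecreasing_of_derive (fun x => phi x - K * x ^ 2 / 2)
      (fun x => phi1 x - K * x)).
    - lra.
    - intros x Hx; apply HD; lra.
    - intros x Hx. rewrite (E x) by lra.
      assert (K <= phi1 x / x) by (apply A3; lra). nra. }
  assert (L2 : phi rho - K * rho ^ 2 / 2 <= phi s - K * s ^ 2 / 2).
  { apply (nonincreasing_of_derive (fun x => phi x - K * x ^ 2 / 2)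
      (fun x => phi1 x - K * x)).
    - lra.
    - intros x Hx; apply HD; lra.
    - intros x Hx. rewrite (E x) by lra.
      assert (phi1 x / x <= K) by (apply A3; lra). nra. }
  assert (4 * s ^ 2 <= rho ^ 2) by nra.
  assert (0 < s ^ 2) by nra.
  clearbody K.
  assert (L3 : phi 0 <= phi s - K * s ^ 2 / 2) by (simpl in L1 |- *; lra).
  destruct (Rle_lt_dec 0 K).
  - assert (0 <= K * s ^ 2) by nra. lra.
  (* With [K < 0], [L2] and [0 <= phi rho] give [- K * (rho ^ 2 - s ^ 2) / 2 <= phi s]; as
     [rho ^ 2 >= 4 * s ^ 2], the correction [- K * s ^ 2 / 2] in [L3] is at most a third of
     [phi s]. *)
  - assert (K * rho ^ 2 <= K * (4 * s ^ 2)) by nra. lra.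
Qed.

(** The square makes the positive part [C^1], the regularity used for translating integrals. *)
Definition bump (t : R) : R := (Rmax 0 t) ^ 2.

Lemma is_derive_bump (t : R) : is_derive bump t (2 * Rmax 0 t).
Proof.
  destruct (Rtotal_order t 0) as [Ht|[->|Ht]].
  - rewrite Rmax_left by lra. rewrite Rmult_0_r.
    apply (is_derive_ext_loc (fun _ => 0)); [|apply (is_derive_const (V := R_NormedModule))].
    apply (filter_imp (fun u => u < 0)); [|now apply (open_lt 0)].
    intros u Hu. unfold bump. rewrite Rmax_left by lra. simpl; ring.
  - rewrite Rmax_left by lra. rewrite Rmult_0_r.
    apply is_derive_Reals. intros eps Heps.
    exists (mkposreal eps Heps). intros h Hh0 Hh. simpl in Hh.
    unfold bump. rewrite Rplus_0_l, (Rmax_left 0 0) by lra.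
    apply Rle_lt_trans with (Rabs h); [|exact Hh].
    destruct (Rle_lt_dec h 0) as [H|H].
    + rewrite Rmax_left by lra.
      replace ((0 ^ 2 - 0 ^ 2) / h - 0) with 0 by (simpl; field; exact Hh0).
      rewrite Rabs_R0. apply Rabs_pos.
    + rewrite Rmax_right by lra.
      replace ((h ^ 2 - 0 ^ 2) / h - 0) with h by (simpl; field; exact Hh0). lra.
  - rewrite Rmax_right by lra.
    apply (is_derive_ext_loc (fun u => u ^ 2)); [|auto_derive; [exact I|ring]].
    apply (filter_imp (fun u => 0 < u)); [|now apply (open_gt 0)].
    intros u Hu. unfold bump. rewrite Rmax_right by lra. reflexivity.
Qed.

Lemma continuity_pt_Rmax0 (t : R) : continuity_pt (fun t => 2 * Rmax 0 t) t.
Proof.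
  apply (continuity_pt_ext (fun t => Rabs t + t)).
  - intros u. unfold Rmax, Rabs. destruct Rle_dec, Rcase_abs; lra.
  - apply continuity_pt_plus; [apply Rcontinuity_abs|apply derivable_continuous_pt, derivable_pt_id].
Qed.

Lemma bump_bounds (t : R) : t <= 1 -> 0 <= bump t <= 1.
Proof.
  intros Ht. unfold bump. unfold Rmax; destruct Rle_dec; simpl; nra.
Qed.

Lemma bump_nonpos (t : R) : t <= 0 -> bump t = 0.
Proof. intros Ht. unfold bump. rewrite Rmax_left by lra. ring. Qed.

Definition disc_bump (rho x0 y0 x y : R) : R :=
  bump (1 - ((x - x0) ^ 2 + (y - y0) ^ 2) / rho ^ 2).

Lemma disc_bump_out (rho x0 y0 x y : R) :
  0 < rho -> rho ^ 2 <= (x - x0) ^ 2 + (y - y0) ^ 2 ->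
  disc_bump rho x0 y0 x y = 0.
Proof.
  intros Hrho Hxy. apply bump_nonpos.
  assert (1 <= ((x - x0) ^ 2 + (y - y0) ^ 2) / rho ^ 2).
  { apply Rle_div_r; [apply pow_lt; lra|lra]. }
  lra.
Qed.

Lemma disc_bump_bounds (rho x0 y0 x y : R) :
  0 < rho -> 0 <= disc_bump rho x0 y0 x y <= 1.
Proof.
  intros Hrho. apply bump_bounds.
  assert (0 <= ((x - x0) ^ 2 + (y - y0) ^ 2) / rho ^ 2).
  { apply Rdiv_le_0_compat; [apply Rplus_le_le_0_compat; apply pow2_ge_0|apply pow_lt; lra]. }
  lra.
Qed.

(* Only the values of [v] on the closed disc matter: elsewhere they are
   multiplied by [0], so that the product is globally [C^1]. *)
Lemma grad_on_cutoff U v vx vy rho x0 y0 :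
  open_2d U -> grad_on U v vx vy -> 0 < rho ->
  (forall x y, (x - x0) ^ 2 + (y - y0) ^ 2 <= rho ^ 2 -> U x y) ->
  exists Gx Gy,
    grad_on (fun _ _ => True) (fun x y => v x y * disc_bump rho x0 y0 x y) Gx Gy.
Proof.
  intros HU Hv Hrho Hdisc.
  set (q := fun x y => 1 - ((x - x0) ^ 2 + (y - y0) ^ 2) / rho ^ 2).
  set (b := fun x y => 2 * Rmax 0 (q x y)).
  assert (Cq : forall x y, continuity_2d_pt q x y).
  { intros x y. unfold q, Rminus, Rdiv, pow. cont2d. }
  assert (Cb : forall x y, continuity_2d_pt b x y).
  { intros x y. apply (continuity_1d_2d_pt_comp (fun t => 2 * Rmax 0 t)).
    - apply continuity_pt_Rmax0.
    - apply Cq. }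
  assert (Cbump : forall x y, continuity_2d_pt (disc_bump rho x0 y0) x y).
  { intros x y. apply (continuity_1d_2d_pt_comp bump q); [|apply Cq].
    apply continuity_pt_filterlim, (ex_derive_continuous (V := R_NormedModule)).
    eexists; apply is_derive_bump. }
  assert (Dqx : forall x y, is_derive (fun t => disc_bump rho x0 y0 t y) x
                  (b x y * (- 2 * (x - x0) / rho ^ 2))).
  { intros x y. rewrite Rmult_comm.
    apply (is_derive_comp bump (fun t => q t y)); [apply is_derive_bump|].
    unfold q. auto_derive; [exact I|]. field. lra. }
  assert (Dqy : forall x y, is_derive (fun t => disc_bump rho x0 y0 x t) y
                  (b x y * (- 2 * (y - y0) / rho ^ 2))).
  { intros x y. rewrite Rmult_comm.
    apply (is_derive_comp bump (fun t => q x t)); [apply is_derive_bump|].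
    unfold q. auto_derive; [exact I|]. field. lra. }
  set (G := fun x y => v x y * disc_bump rho x0 y0 x y).
  set (Gx := fun x y => vx x y * disc_bump rho x0 y0 x y
                        + v x y * (b x y * (- 2 * (x - x0) / rho ^ 2))).
  set (Gy := fun x y => vy x y * disc_bump rho x0 y0 x y
                        + v x y * (b x y * (- 2 * (y - y0) / rho ^ 2))).
  exists Gx, Gy. intros x y _.
  destruct (Rle_lt_dec ((x - x0) ^ 2 + (y - y0) ^ 2) (rho ^ 2)) as [Hin|Hout].
  - pose proof (Hdisc x y Hin) as HUxy.
    destruct (Hv x y HUxy) as (Dx & Dy & Cx & Cy).
    pose proof (grad_on_continuity U v vx vy x y HU Hv HUxy) as Cv.
    split; [|split; [|split]].
    + apply (is_derive_mult (fun t => v t y) (fun t => disc_bump rho x0 y0 t y) x _ _ Dx (Dqx x y)).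
      exact Rmult_comm.
    + apply (is_derive_mult (fun t => v x t) (fun t => disc_bump rho x0 y0 x t) y _ _ Dy (Dqy x y)).
      exact Rmult_comm.
    + unfold Gx, Rdiv, Rminus.
      repeat first [assumption | apply Cbump | apply Cb | cont2d_step].
    + unfold Gy, Rdiv, Rminus.
      repeat first [assumption | apply Cbump | apply Cb | cont2d_step].
  (* The boundary circle went to the first case, where [v] is still [C^1]. Strictly outside the disc
     [q] is negative on a neighbourhood, so the product and its gradient vanish there. *)
  - assert (Hloc : locally_2d (fun x y => q x y < 0) x y).
    { assert (Hq : q x y < 0).
      { unfold q. assert (1 < ((x - x0) ^ 2 + (y - y0) ^ 2) / rho ^ 2); [|lra].
        apply Rlt_div_r; [apply pow_lt; lra|rewrite Rmult_1_l; exact Hout]. }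
      assert (Hp : 0 < - q x y) by lra.
      apply locally_2d_impl with (2 := Cq x y (mkposreal _ Hp)).
      apply locally_2d_forall. intros u w Huw. simpl in Huw.
      apply Rabs_def2 in Huw. lra. }
    assert (Hloc0 : locally_2d (fun x y => G x y = 0 /\ Gx x y = 0 /\ Gy x y = 0) x y).
    { apply locally_2d_impl with (2 := Hloc), locally_2d_forall.
      intros u w Huw. unfold G, Gx, Gy, b.
      change (disc_bump rho x0 y0 u w) with (bump (q u w)).
      rewrite bump_nonpos, Rmax_left by lra. repeat split; ring. }
    destruct (locally_2d_singleton _ _ _ Hloc0) as (_ & Zx & Zy).
    rewrite Zx, Zy.
    split; [|split; [|split]].
    + apply (is_derive_ext_loc (fun _ => 0)); [|apply (is_derive_const (V := R_NormedModule))].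
      apply (locally_2d_1d_const_y (fun x y => 0 = G x y)).
      apply locally_2d_impl with (2 := Hloc0), locally_2d_forall. intuition.
    + apply (is_derive_ext_loc (fun _ => 0)); [|apply (is_derive_const (V := R_NormedModule))].
      apply (locally_2d_1d_const_x (fun x y => 0 = G x y)).
      apply locally_2d_impl with (2 := Hloc0), locally_2d_forall. intuition.
    + apply continuity_2d_pt_ext_loc with (f := fun _ _ => 0); [|apply continuity_2d_pt_const].
      apply locally_2d_impl with (2 := Hloc0), locally_2d_forall. intuition.
    + apply continuity_2d_pt_ext_loc with (f := fun _ _ => 0); [|apply continuity_2d_pt_const].
      apply locally_2d_impl with (2 := Hloc0), locally_2d_forall. intuition.
Qed.

(** * Translation invariance of polar integrals *)

Lemma is_derive_continuity_pt (f : R -> R) (x l : R) :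
  is_derive f x l -> continuity_pt f x.
Proof.
  intros Hf. apply derivable_continuous_pt. exists l. now apply is_derive_Reals.
Qed.

Lemma open_2d_True : open_2d (fun _ _ => True).
Proof. intros x y _. now exists (mkposreal 1 Rlt_0_1). Qed.

Lemma ex_RInt_radius_mean g gx gy x0 y0 a b :
  grad_on (fun _ _ => True) g gx gy ->
  ex_RInt (fun s => s * mean g x0 y0 s) a b.
Proof.
  intros Hg. apply (ex_RInt_continuous (V := R_CompleteNormedModule)); intros s _.
  apply (continuous_mult (K := R_AbsRing)); [apply continuous_id|].
  apply (ex_derive_continuous (V := R_NormedModule)).
  eexists. apply (is_derive_mean (fun _ _ => True) g gx gy x0 y0 (s - 1) (s + 1));
    auto using open_2d_True; lra.
Qed.

(** Mean value theorem plus uniform continuity of the directional derivative on a compact box.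
    Uniformity in [(x, y)] is what allows this estimate to be integrated over angles and radii. *)
Lemma translate_first_order g gx gy (p q L : R) (eps : posreal) :
  grad_on (fun _ _ => True) g gx gy ->
  exists d : posreal, forall x y a b,
    Rabs x <= L -> Rabs y <= L -> Rabs a <= 2 -> Rabs (b - a) < d ->
    Rabs (g (x + b * p) (y + b * q) - g (x + a * p) (y + a * q)
      - (b - a) * (p * gx (x + a * p) (y + a * q) + q * gy (x + a * p) (y + a * q)))
    <= eps * Rabs (b - a).
Proof.
  intros Hg.
  set (e := fun x y => p * gx x y + q * gy x y).
  set (N := Rabs p + Rabs q + 1).
  assert (HN : 0 < N) by (unfold N; pose proof (Rabs_pos p); pose proof (Rabs_pos q); lra).
  (* All points met are [(x + c * p, y + c * q)] with [|c| <= 3], because [|a| <= 2] and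
     [|b - a| < 1]. *)
  set (M := L + 3 * N).
  destruct (uniform_continuity_2d e (- M) M (- M) M) with (eps := eps) as [d Hd].
  { intros x y _ _. destruct (Hg x y I) as (_ & _ & ? & ?). unfold e. now cont2d. }
  assert (Hd' : 0 < Rmin 1 (d / N)).
  { apply Rmin_pos; [lra|]. apply Rdiv_lt_0_compat; [apply cond_pos|exact HN]. }
  exists (mkposreal _ Hd'). simpl. intros x y a b Hx Hy Ha Hab.
  assert (Hab1 : Rabs (b - a) < 1) by (eapply Rlt_le_trans; [exact Hab|apply Rmin_l]).
  assert (Hab2 : Rabs (b - a) * N < d).
  { apply Rlt_div_r; [exact HN|].
    eapply Rlt_le_trans; [exact Hab|apply Rmin_r]. }
  assert (HD : forall c, is_derive (fun a => g (x + a * p) (y + a * q)) c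
                 (e (x + c * p) (y + c * q))).
  { intros c. unfold e. rewrite (Rmult_comm p), (Rmult_comm q).
    apply (grad_on_comp (fun _ _ => True) g gx gy (fun a => x + a * p) (fun a => y + a * q));
      auto using open_2d_True; auto_derive; auto; ring. }
  destruct (MVT_gen (fun a => g (x + a * p) (y + a * q)) a b
              (fun c => e (x + c * p) (y + c * q))) as (c & Hc & Hmvt).
  { intros c _. apply HD. }
  { intros c _. exact (is_derive_continuity_pt _ _ _ (HD c)). }
  rewrite Hmvt.
  fold (e (x + a * p) (y + a * q)).
  replace (e (x + c * p) (y + c * q) * (b - a) - (b - a) * e (x + a * p) (y + a * q))
    with ((e (x + c * p) (y + c * q) - e (x + a * p) (y + a * q)) * (b - a)) by ring.
  rewrite Rabs_mult. apply Rmult_le_compat_r; [apply Rabs_pos|].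
  assert (Hca : Rabs (c - a) <= Rabs (b - a)).
  { revert Hc. unfold Rmin, Rmax. destruct Rle_dec; intros Hc; unfold Rabs;
      destruct (Rcase_abs (c - a)), (Rcase_abs (b - a)); lra. }
  assert (Hbox : forall z t r, Rabs z <= L -> Rabs t <= 3 -> Rabs r <= N -> - M <= z + t * r <= M).
  { intros z t r Hz Ht Hr. apply Rabs_le_between.
    apply Rle_trans with (1 := Rabs_triang _ _). unfold M.
    rewrite Rabs_mult.
    assert (Rabs t * Rabs r <= 3 * N) by (apply Rmult_le_compat; auto using Rabs_pos). lra. }
  assert (Hp : Rabs p <= N) by (unfold N; pose proof (Rabs_pos q); lra).
  assert (Hq : Rabs q <= N) by (unfold N; pose proof (Rabs_pos p); lra).
  assert (Hc3 : Rabs c <= 3).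
  { replace c with (a + (c - a)) by ring.
    apply Rle_trans with (1 := Rabs_triang _ _). lra. }
  assert (Hmove : forall z r, Rabs r <= N -> Rabs (z + c * r - (z + a * r)) < d).
  { intros z r Hr. replace (z + c * r - (z + a * r)) with ((c - a) * r) by ring.
    rewrite Rabs_mult. apply Rle_lt_trans with (2 := Hab2).
    apply Rmult_le_compat; auto using Rabs_pos. }
  left. apply Hd; try apply Hbox; auto; lra.
Qed.

(* With [e = p g_x + q g_y], the [a]-derivative of [s * mean g (a p) (a q) s] is
   [s * mean e], which is the [s]-derivative of [s * flux (p g) (q g)]; this
   flux vanishes at [0] and, by the support condition, at [S]. *)
Lemma is_derive_translated_integral g gx gy (p q S a : R) :
  grad_on (fun _ _ => True) g gx gy -> 0 <= S -> Rabs a <= 2 ->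
  (forall t, g (a * p + S * cos t) (a * q + S * sin t) = 0) ->
  is_derive (fun a => RInt (fun s => s * mean g (a * p) (a * q) s) 0 S) a 0.
Proof.
  intros Hg HS Ha Hsupp.
  set (T := fun _ _ : R => True).
  pose proof open_2d_True as HT. fold T in HT, Hg.
  set (e := fun x y => p * gx x y + q * gy x y).
  set (X := fun x y => p * g x y). set (Y := fun x y => q * g x y).
  assert (Cg : forall x y, continuity_2d_pt g x y)
    by (intros; now apply (grad_on_continuity T g gx gy)).
  assert (Ce : forall x y, continuity_2d_pt e x y).
  { intros x y. destruct (Hg x y I) as (_ & _ & ? & ?). unfold e. now cont2d. }
  assert (HX : forall r, grad_on T (fun x y => r * g x y)
                (fun x y => r * gx x y) (fun x y => r * gy x y)).
  { intros r x y _. destruct (Hg x y I) as (Dx & Dy & ? & ?).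
    split; [|split; [|split]].
    - now apply (is_derive_scal (fun t => g t y)).
    - now apply (is_derive_scal (fun t => g x t)).
    - now cont2d.
    - now cont2d. }
  apply is_derive_Reals. intros eps Heps.
  (* [S * S * (2 * PI)] is what the three integrations (angle, factor [u], radius) cost; the [+ 1]
     keeps [C] positive when [S = 0]. *)
  set (C := S * S * (2 * PI) + 1).
  assert (HPI := PI_RGT_0).
  assert (HC : 0 < C) by (unfold C; nra).
  assert (HeC : 0 < eps / 2 / C) by (apply Rdiv_lt_0_compat; lra).
  destruct (translate_first_order g gx gy p q S (mkposreal _ HeC) Hg) as [d Hd].
  simpl in Hd.
  exists d. intros h Hh0 Hh. rewrite Rminus_0_r.
  set (b := a + h).
  set (eta := eps / 2 / C * Rabs h).
  (* The increment of the integral minus its first-order term, as a function of the upper bound [u].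
     It vanishes at 0 and has a small derivative by [translate_first_order], so it is small at [S],
     where the flux term is zero. No interchange of integrals is involved. *)
  set (D := fun u => RInt (fun s => s * mean g (b * p) (b * q) s) 0 u
                   - RInt (fun s => s * mean g (a * p) (a * q) s) 0 u
                   - h * (u * flux X Y (a * p) (a * q) u)).
  set (D' := fun u => u * mean g (b * p) (b * q) u - u * mean g (a * p) (a * q) u
                   - h * (u * mean e (a * p) (a * q) u)).
  assert (HD : forall u, is_derive D u (D' u)).
  { assert (HI : forall c u, is_derive (fun u => RInt (fun s => s * mean g (c * p) (c * q) s) 0 u) u
                   (u * mean g (c * p) (c * q) u)).
    { intros c u.
      apply (is_derive_RInt (fun s => s * mean g (c * p) (c * q) s) _ 0).
      - apply filter_forall. intros w. apply (RInt_correct (V := R_CompleteNormedModule)).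
        now apply (ex_RInt_radius_mean g gx gy).
      - apply (continuous_mult (K := R_AbsRing)); [apply continuous_id|].
        apply (ex_derive_continuous (V := R_NormedModule)).
        eexists. apply (is_derive_mean T g gx gy _ _ (u - 1) (u + 1)); unfold T; auto; lra. }
    intros u. unfold D, D'.
    apply (is_derive_minus
      (fun u => RInt (fun s => s * mean g (b * p) (b * q) s) 0 u
              - RInt (fun s => s * mean g (a * p) (a * q) s) 0 u)
      (fun u => h * (u * flux X Y (a * p) (a * q) u))).
    - apply (is_derive_minus
        (fun u => RInt (fun s => s * mean g (b * p) (b * q) s) 0 u)); apply HI.
    - apply (is_derive_scal (fun u => u * flux X Y (a * p) (a * q) u)).
      apply (is_derive_radius_flux T X (fun x y => p * gx x y) (fun x y => p * gy x y)
        Y (fun x y => q * gx x y) (fun x y => q * gy x y) _ _ (u - 1) (u + 1));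
        unfold T; auto; [apply (HX p)|apply (HX q)|lra]. }
  assert (HD'b : forall u, 0 <= u <= S -> Rabs (D' u) <= S * (2 * PI * eta)).
  { intros u Hu. unfold D', mean.
    set (A := RInt (fun t => g (b * p + u * cos t) (b * q + u * sin t)) 0 (2 * PI)).
    set (B := RInt (fun t => g (a * p + u * cos t) (a * q + u * sin t)) 0 (2 * PI)).
    set (E := RInt (fun t => e (a * p + u * cos t) (a * q + u * sin t)) 0 (2 * PI)).
    replace (u * A - u * B - h * (u * E)) with (u * (A - B - h * E)) by ring.
    rewrite Rabs_mult, (Rabs_pos_eq u) by lra.
    apply Rmult_le_compat; [lra|apply Rabs_pos|lra|].
    assert (IA := ex_RInt_polar g (b * p) (b * q) u 0 (2 * PI) (fun t => Cg _ _)).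
    assert (IB := ex_RInt_polar g (a * p) (a * q) u 0 (2 * PI) (fun t => Cg _ _)).
    assert (IE := ex_RInt_polar e (a * p) (a * q) u 0 (2 * PI) (fun t => Ce _ _)).
    set (k := fun t => g (b * p + u * cos t) (b * q + u * sin t)
        - g (a * p + u * cos t) (a * q + u * sin t)
        - h * e (a * p + u * cos t) (a * q + u * sin t)).
    assert (Hk : is_RInt k 0 (2 * PI) (A - B - h * E)).
    { apply (is_RInt_minus (V := R_NormedModule)
        (fun t => g (b * p + u * cos t) (b * q + u * sin t)
        - g (a * p + u * cos t) (a * q + u * sin t))
        (fun t => h * e (a * p + u * cos t) (a * q + u * sin t)) 0 (2 * PI) (A - B) (h * E)).
      - apply (is_RInt_minus (V := R_NormedModule)
          (fun t => g (b * p + u * cos t) (b * q + u * sin t))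
          (fun t => g (a * p + u * cos t) (a * q + u * sin t)) 0 (2 * PI) A B);
          now apply (RInt_correct (V := R_CompleteNormedModule)).
      - apply (is_RInt_scal (V := R_NormedModule)
          (fun t => e (a * p + u * cos t) (a * q + u * sin t))).
        now apply (RInt_correct (V := R_CompleteNormedModule)). }
    rewrite <- (is_RInt_unique _ _ _ _ Hk).
    replace (2 * PI * eta) with ((2 * PI - 0) * eta) by ring.
    apply abs_RInt_le_const; [lra|now eexists; exact Hk|].
    intros t _. unfold k, eta.
    replace h with (b - a) by (unfold b; ring).
    (* The point of the circle about the origin is taken as base point and the centre as
       displacement, so that the base point stays in the box of half-side [S]. *)
    rewrite !(Rplus_comm (_ * p)), !(Rplus_comm (_ * q)).
    assert (Htrig : forall w, Rabs w <= 1 -> Rabs (u * w) <= S).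
    { intros w Hw. rewrite Rabs_mult, (Rabs_pos_eq u) by lra.
      pose proof (Rabs_pos w). nra. }
    apply Hd.
    - apply Htrig, Rabs_le, COS_bound.
    - apply Htrig, Rabs_le, SIN_bound.
    - exact Ha.
    - unfold b. now replace (a + h - a) with h by ring. }
  assert (HD0 : D 0 = 0).
  { unfold D. rewrite !RInt_point. unfold zero; simpl. ring. }
  assert (Hflux : flux X Y (a * p) (a * q) S = 0).
  { unfold flux. rewrite (RInt_ext _ (fun _ => 0)).
    - rewrite RInt_const. unfold scal; simpl; unfold mult; simpl; ring.
    - intros t _. unfold X, Y. rewrite Hsupp. simpl; ring. }
  assert (HDS : Rabs (D S) <= S * (S * (2 * PI * eta))).
  { destruct (MVT_gen D 0 S D') as (c & Hc & Hmvt).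
    - intros; apply HD.
    - intros c _. exact (is_derive_continuity_pt _ _ _ (HD c)).
    - rewrite Rmin_left, Rmax_right in Hc by lra.
      rewrite HD0, !Rminus_0_r in Hmvt. rewrite Hmvt, Rabs_mult, (Rabs_pos_eq S) by lra.
      rewrite Rmult_comm. apply Rmult_le_compat_l; [lra|now apply HD'b]. }
  unfold D in HDS. rewrite Hflux, !Rmult_0_r, Rminus_0_r in HDS.
  fold b. unfold Rdiv. rewrite Rabs_mult, Rabs_inv.
  apply Rabs_pos_lt in Hh0.
  apply Rlt_div_l; [exact Hh0|].
  apply Rle_lt_trans with (1 := HDS).
  unfold eta.
  replace (S * (S * (2 * PI * (eps / 2 / C * Rabs h))))
    with ((C - 1) / C * (eps / 2 * Rabs h)) by (unfold C; field; fold C; lra).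
  assert ((C - 1) / C < 1) by (apply Rlt_div_l; lra).
  assert (0 < eps / 2 * Rabs h) by nra.
  assert ((C - 1) / C * (eps / 2 * Rabs h) < 1 * (eps / 2 * Rabs h))
    by (apply Rmult_lt_compat_r; lra).
  lra.
Qed.

(** Replaces a change of variables between polar coordinates about two centres: the centre moves
    along the segment from the origin to [(p, q)], and nothing enters or leaves the moving disc
    because [g] vanishes on each of its boundary circles. *)
Lemma translation_invariance g gx gy (p q S : R) :
  grad_on (fun _ _ => True) g gx gy -> 0 <= S ->
  (forall a t, 0 <= a <= 1 -> g (a * p + S * cos t) (a * q + S * sin t) = 0) ->
  RInt (fun s => s * mean g p q s) 0 S = RInt (fun s => s * mean g 0 0 s) 0 S.
Proof.
  intros Hg HS Hsupp.
  set (Q := fun a => RInt (fun s => s * mean g (a * p) (a * q) s) 0 S).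
  assert (HQ : forall a, 0 <= a <= 1 -> is_derive Q a 0).
  { intros a Ha. 
    assert (Ha2 : Rabs a <= 2) by (apply Rabs_le; lra).
    exact (is_derive_translated_integral g gx gy p q S a Hg HS Ha2
      (fun t => Hsupp a t Ha)). }
  assert (E : Q 1 = Q 0).
  { apply Rle_antisym.
    - apply (nonincreasing_of_derive Q (fun _ => 0)); auto; intros; lra.
    - apply (nondecreasing_of_derive Q (fun _ => 0)); auto; intros; lra. }
  unfold Q in E. now rewrite !Rmult_1_l, !Rmult_0_l in E.
Qed.

(** * Pointwise bound by circular means *)

(** Mixed second derivatives are included since the divergence formula on circles also
    differentiates the gradient along the angle. *)
Definition lap_on (U : R -> R -> Prop) (g h : R -> R -> R) : Prop :=
  exists gx gy gxx gxy gyx gyy,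
    grad_on U g gx gy /\ grad_on U gx gxx gxy /\ grad_on U gy gyx gyy /\
    forall x y, U x y -> h x y = gxx x y + gyy x y.

Lemma lap_on_continuity U g h x y :
  open_2d U -> lap_on U g h -> U x y ->
  continuity_2d_pt g x y /\ continuity_2d_pt h x y.
Proof.
  intros HU (gx & gy & gxx & gxy & gyx & gyy & H1 & H2 & H3 & H4) Hxy. split.
  - now apply (grad_on_continuity U g gx gy).
  - apply continuity_2d_pt_ext_loc with (f := fun x y => gxx x y + gyy x y).
    + apply locally_2d_impl with (2 := HU x y Hxy), locally_2d_forall.
      intros u w Huw. symmetry. now apply H4.
    + destruct (H2 x y Hxy) as (_ & _ & ? & _), (H3 x y Hxy) as (_ & _ & _ & ?).
      now cont2d.
Qed.

(** Polar form of the Laplacian of a radial function. [phi] is chosen before the interval of radii,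
    so that one function serves all annuli about the same centre. *)
Lemma lap_on_mean U g h x0 y0 :
  open_2d U -> lap_on U g h ->
  exists phi, forall s1 s2 s,
    (forall u t, s1 < u < s2 -> U (x0 + u * cos t) (y0 + u * sin t)) ->
    s1 < s < s2 ->
    is_derive (mean g x0 y0) s (phi s) /\
    is_derive (fun s => s * phi s) s (s * mean h x0 y0 s).
Proof.
  intros HU (gx & gy & gxx & gxy & gyx & gyy & H1 & H2 & H3 & H4).
  exists (flux gx gy x0 y0). intros s1 s2 s Hc Hs. split.
  - now apply (is_derive_mean U g gx gy x0 y0 s1 s2).
  - replace (mean h x0 y0 s) with (mean (fun x y => gxx x y + gyy x y) x0 y0 s).
    + now apply (is_derive_radius_flux U gx gxx gxy gy gyx gyy x0 y0 s1 s2).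
    + apply RInt_ext. intros t _. symmetry. now apply H4, Hc.
Qed.

Lemma mean_le U g h x0 y0 s :
  (forall x y, U x y -> continuity_2d_pt g x y) ->
  (forall x y, U x y -> continuity_2d_pt h x y) ->
  (forall t, U (x0 + s * cos t) (y0 + s * sin t)) ->
  (forall t, g (x0 + s * cos t) (y0 + s * sin t)
             <= h (x0 + s * cos t) (y0 + s * sin t)) ->
  mean g x0 y0 s <= mean h x0 y0 s.
Proof.
  intros Hg Hh Hc Hle.
  assert (HPI := PI_RGT_0).
  apply RInt_le; [lra| | |auto].
  - apply ex_RInt_polar; auto.
  - apply ex_RInt_polar; auto.
Qed.

Lemma mean_const c x0 y0 s : mean (fun _ _ => c) x0 y0 s = 2 * PI * c.
Proof.
  unfold mean. rewrite RInt_const. unfold scal; simpl; unfold mult; simpl; ring.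
Qed.

Lemma mean_nonneg U g x0 y0 s :
  (forall x y, U x y -> continuity_2d_pt g x y) ->
  (forall t, U (x0 + s * cos t) (y0 + s * sin t)) ->
  (forall t, 0 <= g (x0 + s * cos t) (y0 + s * sin t)) ->
  0 <= mean g x0 y0 s.
Proof.
  intros Hg Hc Hpos.
  rewrite <- (Rmult_0_r (2 * PI)), <- (mean_const 0 x0 y0 s).
  apply (mean_le U); auto.
  intros; apply continuity_2d_pt_const.
Qed.

Lemma mean_zero g x0 y0 s :
  (forall t, g (x0 + s * cos t) (y0 + s * sin t) = 0) -> mean g x0 y0 s = 0.
Proof.
  intros Hg. rewrite <- (Rmult_0_r (2 * PI)), <- (mean_const 0 x0 y0 s).
  apply RInt_ext. intros t _. apply Hg.
Qed.

Lemma mean_center g x0 y0 : mean g x0 y0 0 = 2 * PI * g x0 y0.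
Proof.
  rewrite <- (mean_const (g x0 y0) x0 y0 0). apply RInt_ext.
  intros t _. f_equal; ring.
Qed.

Lemma center_le_mean U v w b x0 y0 rho rho' s :
  open_2d U -> lap_on U v w -> lap_on U w b ->
  (forall x y, U x y -> b x y <= 0) -> (forall x y, U x y -> 0 < v x y) ->
  (forall u t, - rho' < u < rho' -> U (x0 + u * cos t) (y0 + u * sin t)) ->
  rho < rho' -> 0 < s <= rho / 2 ->
  2 * PI * v x0 y0 <= 4 / 3 * mean v x0 y0 s.
Proof.
  intros HU Hv Hw Hb Hpos Hc Hrho Hs.
  destruct (lap_on_mean U v w x0 y0 HU Hv) as [phi Hphi].
  destruct (lap_on_mean U w b x0 y0 HU Hw) as [psi Hpsi].
  assert (Hmv : forall u, - rho' < u < rho' -> 0 <= mean v x0 y0 u).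
  { intros u Hu. apply (mean_nonneg U).
    - intros x y Hxy. now apply (lap_on_continuity U v w x y).
    - auto.
    - intros t. left; auto. }
  rewrite <- mean_center.
  apply (radial_center_le (mean v x0 y0) phi (mean w x0 y0) psi (mean b x0 y0) rho rho' s).
  - intros u Hu. apply (Hphi _ _ u Hc Hu).
  - intros u Hu. apply (Hphi _ _ u Hc Hu).
  - intros u Hu. apply (Hpsi _ _ u Hc Hu).
  - intros u Hu. apply (Hpsi _ _ u Hc Hu).
  - intros u Hu. rewrite <- (Rmult_0_r (2 * PI)), <- (mean_const 0 x0 y0 u).
    apply (mean_le U).
    + intros x y Hxy. now apply (lap_on_continuity U w b x y).
    + intros; apply continuity_2d_pt_const.
    + auto.
    + intros t. auto.
  - exact Hrho.
  - apply Hmv; lra.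
  - exact Hs.
  - apply Hmv; lra.
Qed.

Definition outside (r0 x y : R) : Prop := r0 ^ 2 < x ^ 2 + y ^ 2.

Lemma open_outside r0 : open_2d (outside r0).
Proof.
  intros x y Hxy. unfold outside in *.
  assert (C : continuity_2d_pt (fun x y => x ^ 2 + y ^ 2) x y) by (unfold pow; cont2d).
  assert (Hp : 0 < x ^ 2 + y ^ 2 - r0 ^ 2) by lra.
  apply locally_2d_impl with (2 := C (mkposreal _ Hp)), locally_2d_forall.
  intros u w Huw. simpl pos in Huw. apply Rabs_def2 in Huw. lra.
Qed.

Lemma polar_dot_le x y r t :
  0 <= r -> x ^ 2 + y ^ 2 = r ^ 2 -> - r <= x * cos t + y * sin t <= r.
Proof.
  intros Hr Hxy. apply Rabs_le_between.
  pose proof (sin2_cos2 t) as H. unfold Rsqr in H.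
  rewrite <- (Rabs_pos_eq r Hr). apply Rsqr_le_abs_0. unfold Rsqr.
  (* Lagrange's identity, which gives the Cauchy-Schwarz inequality with explicit remainder. *)
  assert (E : (x * cos t + y * sin t) * (x * cos t + y * sin t)
    = (x ^ 2 + y ^ 2) * (sin t * sin t + cos t * cos t)
      - (x * sin t - y * cos t) * (x * sin t - y * cos t)) by ring.
  rewrite E, H, Hxy. pose proof (Rle_0_sqr (x * sin t - y * cos t)) as K.
  unfold Rsqr in K. lra.
Qed.

Lemma circle_dist x y s t :
  (x + s * cos t) ^ 2 + (y + s * sin t) ^ 2
  = x ^ 2 + y ^ 2 + 2 * s * (x * cos t + y * sin t) + s ^ 2.
Proof.
  pose proof (sin2_cos2 t) as H. unfold Rsqr in H.
  replace (s ^ 2) with (s ^ 2 * (sin t * sin t + cos t * cos t)) by (rewrite H; ring).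
  ring.
Qed.

(* Integrate [center_le_mean] against a bump supported in the disc of radius
   [r / 2] around the point; translation invariance turns the result into an
   integral of circular means around the origin. *)
Lemma pointwise_le_mean r0 v w b x0 y0 r B :
  0 < r0 -> lap_on (outside r0) v w -> lap_on (outside r0) w b ->
  (forall x y, outside r0 x y -> b x y <= 0) ->
  (forall x y, outside r0 x y -> 0 < v x y) ->
  4 * r0 < r -> x0 ^ 2 + y0 ^ 2 = r ^ 2 ->
  (forall s, r / 2 <= s <= 3 * r / 2 -> mean v 0 0 s <= B) ->
  v x0 y0 <= 400 * B.
Proof.
  intros Hr0 Hv Hw Hb Hpos Hr Hxy HB.
  set (U := outside r0) in *.
  pose proof (open_outside r0 : open_2d U) as HU.
  assert (HPI : 3 < 2 * PI).
  { pose proof PI2_3_2. unfold PI2 in *. lra. }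
  set (rho := r / 2).
  assert (Hrho : 0 < rho) by (unfold rho; lra).
  assert (Hdisc : forall x y, (x - x0) ^ 2 + (y - y0) ^ 2 <= rho ^ 2 -> U x y).
  { intros x y H. unfold U, outside, rho in *.
    pose proof (pow2_ge_0 (2 * x - x0)). pose proof (pow2_ge_0 (2 * y - y0)). nra. }
  (* Such points are at distance more than [r / 4 > r0] from the origin; [3 * r / 4] exceeds [rho],
     as [center_le_mean] requires. *)
  assert (Hcirc : forall u t, - (3 * r / 4) < u < 3 * r / 4 ->
            U (x0 + u * cos t) (y0 + u * sin t)).
  { intros u t Hu. unfold U, outside. rewrite circle_dist, Hxy.
    pose proof (polar_dot_le x0 y0 r t ltac:(lra) Hxy).
    destruct (Rle_lt_dec 0 u); nra. }
  assert (Cv : forall x y, U x y -> continuity_2d_pt v x y).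
  { intros x y H. now apply (lap_on_continuity U v w). }
  set (beta := disc_bump rho x0 y0).
  set (G := fun x y => v x y * beta x y).
  assert (HG : exists Gx Gy, grad_on (fun _ _ => True) G Gx Gy).
  { destruct Hv as (vx & vy & _ & _ & _ & _ & Hv & _).
    now apply (grad_on_cutoff U v vx vy rho x0 y0). }
  destruct HG as (Gx & Gy & HG).
  assert (CG : forall x y, True -> continuity_2d_pt G x y).
  { intros x y _. apply (grad_on_continuity (fun _ _ => True) G Gx Gy); auto using open_2d_True. }
  assert (Gout : forall x y, rho ^ 2 <= (x - x0) ^ 2 + (y - y0) ^ 2 -> G x y = 0).
  { intros x y H. unfold G, beta. rewrite disc_bump_out; auto; ring. }
  assert (G0 : forall x y, 0 <= G x y).
  { intros x y. destruct (Rle_lt_dec (rho ^ 2) ((x - x0) ^ 2 + (y - y0) ^ 2)) as [H|H].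
    - rewrite Gout; auto; lra.
    - apply Rmult_le_pos; [left; apply Hpos, Hdisc; lra|].
      now apply disc_bump_bounds. }
  assert (GmeanPos : forall p q s, 0 <= mean G p q s).
  { intros p q s. apply (mean_nonneg (fun _ _ => True)); auto. }
  (* A circle of radius [4 * r] about any point of the segment from 0 to [(x0, y0)] stays at
     distance at least [3 * r] from [(x0, y0)], hence off the support of [G]. *)
  assert (HT : RInt (fun s => s * mean G x0 y0 s) 0 (4 * r)
             = RInt (fun s => s * mean G 0 0 s) 0 (4 * r)).
  { apply (translation_invariance G Gx Gy); [exact HG|lra|].
    intros a t Ha. apply Gout. unfold rho.
    replace (a * x0 + 4 * r * cos t - x0) with ((a - 1) * x0 + 4 * r * cos t) by ring.
    replace (a * y0 + 4 * r * sin t - y0) with ((a - 1) * y0 + 4 * r * sin t) by ring.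
    rewrite circle_dist.
    pose proof (polar_dot_le x0 y0 r t ltac:(lra) Hxy).
    assert (r * - r <= r * ((a - 1) * x0 * cos t + (a - 1) * y0 * sin t)).
    { apply Rmult_le_compat_l; [lra|].
      replace ((a - 1) * x0 * cos t + (a - 1) * y0 * sin t)
        with ((a - 1) * (x0 * cos t + y0 * sin t)) by ring. nra. }
    pose proof (pow2_ge_0 ((a - 1) * x0)). pose proof (pow2_ge_0 ((a - 1) * y0)). nra. }
  assert (IG : forall p q c d, ex_RInt (fun s => s * mean G p q s) c d)
    by (intros; now apply (ex_RInt_radius_mean G Gx Gy)).
  assert (Bpos : 0 <= B).
  { apply Rle_trans with (mean v 0 0 r); [|apply HB; lra].
    assert (Hc : forall t, U (0 + r * cos t) (0 + r * sin t)).
    { intros t. unfold U, outside. rewrite circle_dist. nra. }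
    apply (mean_nonneg U); auto.
    intros; left; auto. }
  assert (Upper : RInt (fun s => s * mean G 0 0 s) 0 (4 * r) <= 4 * r * (3 * r / 2 * B)).
  { replace (4 * r * (3 * r / 2 * B)) with (RInt (fun _ => 3 * r / 2 * B) 0 (4 * r)).
    2: { rewrite RInt_const. unfold scal; simpl; unfold mult; simpl; ring. }
    apply RInt_le; [lra|apply IG|apply ex_RInt_const|].
    intros s Hs.
    (* Circles about the origin meet the open disc of radius [r / 2] about [(x0, y0)] only if their
       radius is between [r / 2] and [3 * r / 2]. *)
    destruct (Rlt_dec s (r / 2)) as [H1|H1]; [|destruct (Rlt_dec (3 * r / 2) s) as [H2|H2]].
    1, 2: replace (mean G 0 0 s) with 0; [rewrite Rmult_0_r; nra|].
    1, 2: symmetry; apply mean_zero; intros t; apply Gout; unfold rho;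
      pose proof (polar_dot_le x0 y0 r t ltac:(lra) Hxy);
      replace (0 + s * cos t - x0) with (- x0 + s * cos t) by ring;
      replace (0 + s * sin t - y0) with (- y0 + s * sin t) by ring;
      rewrite circle_dist;
      replace (- x0 * cos t + - y0 * sin t) with (- (x0 * cos t + y0 * sin t)) by ring;
      nra.
    assert (mean G 0 0 s <= B).
    { apply Rle_trans with (mean v 0 0 s); [|apply HB; lra].
      assert (Hc : forall t, U (0 + s * cos t) (0 + s * sin t)).
      { intros t. unfold U, outside. rewrite circle_dist. nra. }
      apply (mean_le U); auto.
      intros t. unfold G.
      pose proof (disc_bump_bounds rho x0 y0 (0 + s * cos t) (0 + s * sin t) Hrho) as Hbb.
      specialize (Hpos _ _ (Hc t)). fold beta in Hbb. nra. }
    apply Rmult_le_compat; auto; lra. }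
  (* Lower bound of the integrand for radii in [[rho / 4, rho / 2]]: [rho / 4] bounds [s], [9 / 16]
     is the bump at half its radius, [3 / 4] inverts the [4 / 3] of [center_le_mean]. *)
  set (c := rho / 4 * (9 / 16 * (3 / 4 * (2 * PI * v x0 y0)))).
  assert (Lower : rho / 4 * c <= RInt (fun s => s * mean G x0 y0 s) 0 (4 * r)).
  { rewrite <- (RInt_Chasles (V := R_CompleteNormedModule) _ 0 (rho / 4)),
      <- (RInt_Chasles (V := R_CompleteNormedModule) _ (rho / 4) (rho / 2)); auto.
    unfold plus; simpl.
    assert (A1 : 0 <= RInt (fun s => s * mean G x0 y0 s) 0 (rho / 4)).
    { apply RInt_ge_0; auto; [lra|]. intros s Hs. apply Rmult_le_pos; auto; lra. }
    assert (A2 : 0 <= RInt (fun s => s * mean G x0 y0 s) (rho / 2) (4 * r)).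
    { apply RInt_ge_0; auto; [unfold rho; lra|]. intros s Hs. apply Rmult_le_pos; auto; lra. }
    enough (rho / 4 * c <= RInt (fun s => s * mean G x0 y0 s) (rho / 4) (rho / 2)) by lra.
    replace (rho / 4 * c) with (RInt (fun _ => c) (rho / 4) (rho / 2)).
    2: { rewrite RInt_const. unfold scal; simpl; unfold mult; simpl; field. }
    apply RInt_le; [lra|apply ex_RInt_const|apply IG|].
    intros s Hs. unfold c.
    assert (Hcs : forall t, U (x0 + s * cos t) (y0 + s * sin t)).
    { intros t. apply Hcirc. unfold rho in Hs. lra. }
    assert (C1 : 2 * PI * v x0 y0 <= 4 / 3 * mean v x0 y0 s).
    { apply (center_le_mean U v w b x0 y0 rho (3 * r / 4)); auto; unfold rho in *; lra. }
    assert (C2 : 9 / 16 * mean v x0 y0 s <= mean G x0 y0 s).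
    { replace (9 / 16 * mean v x0 y0 s) with (mean (fun x y => 9 / 16 * v x y) x0 y0 s).
      2: { apply (RInt_scal (V := R_CompleteNormedModule) (fun t => v (x0 + s * cos t) (y0 + s * sin t))).
           apply ex_RInt_polar; auto. }
      apply (mean_le U); auto.
      - intros x y H. apply continuity_2d_pt_mult; [apply continuity_2d_pt_const|auto].
      - intros t. unfold G. rewrite Rmult_comm.
        apply Rmult_le_compat_l; [left; auto|].
        unfold beta, disc_bump.
        replace (x0 + s * cos t - x0) with (0 + s * cos t) by ring.
        replace (y0 + s * sin t - y0) with (0 + s * sin t) by ring.
        rewrite circle_dist.
        replace ((0 ^ 2 + 0 ^ 2 + 2 * s * (0 * cos t + 0 * sin t) + s ^ 2) / rho ^ 2)
          with ((s / rho) ^ 2) by (field; lra).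
        assert (0 < s / rho < 1 / 2).
        { split; [apply Rdiv_lt_0_compat; lra|apply Rlt_div_l; lra]. }
        unfold bump. rewrite Rmax_right by nra.
        assert (3 / 4 <= 1 - (s / rho) ^ 2) by nra. nra. }
    assert (0 < v x0 y0) by (apply Hpos; unfold U, outside; nra).
    assert (0 <= 2 * PI * v x0 y0) by nra.
    apply Rmult_le_compat; lra. }
  rewrite HT in Lower.
  pose proof (Rle_trans _ _ _ Lower Upper) as Final.
  assert (Hv0 : 0 < v x0 y0) by (apply Hpos; unfold U, outside; nra).
  unfold c, rho in Final.
  (* [384 = 64 * 6], from [(rho / 4) ^ 2 = r ^ 2 / 64] and the upper bound [6 * r ^ 2 * B]. Then
     [v x0 y0 <= 384 * 64 / 81 * B], below [400 * B]. *)
  assert (F2 : r ^ 2 * (9 / 16 * (3 / 4 * (3 * v x0 y0))) <= r ^ 2 * (384 * B)).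
  { apply Rle_trans with (r ^ 2 * (9 / 16 * (3 / 4 * (2 * PI * v x0 y0)))); [|lra].
    apply Rmult_le_compat_l; nra. }
  apply Rmult_le_reg_l in F2; [lra|nra].
Qed.

(** * Growth of the circular mean *)

(** The integration constant is absorbed into the multiple of [H] because [H >= 1]. *)
Lemma le_comparison_multiple (f df H dH : R -> R) (r C : R) :
  0 <= C ->
  (forall s, r <= s -> is_derive f s (df s)) ->
  (forall s, r <= s -> is_derive H s (dH s)) ->
  (forall s, r <= s -> df s <= C * dH s) ->
  (forall s, r <= s -> 1 <= H s) ->
  exists C', 0 <= C' /\ forall s, r <= s -> f s <= C' * H s.
Proof.
  intros HC Hf HH Hle H1.
  exists (C + Rabs (f r - C * H r)).
  pose proof (Rabs_pos (f r - C * H r)) as Ha.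
  split; [lra|]. intros s Hs.
  assert (K : f s - C * H s <= f r - C * H r).
  { apply (nonincreasing_of_derive (fun s => f s - C * H s) (fun s => df s - C * dH s)); auto.
    - intros x Hx. apply (is_derive_minus f (fun s => C * H s)); [apply Hf; lra|].
      apply is_derive_scal, HH; lra.
    - intros x Hx. assert (df x <= C * dH x) by (apply Hle; lra). lra. }
  pose proof (Rle_abs (f r - C * H r)). specialize (H1 s Hs). nra.
Qed.

(** [f + a * H] is nonincreasing while [H] tends to infinity. Applied with [H = ln] and with
    [H = ln ln]. *)
Lemma eventually_le_of_derive (f df H dH : R -> R) (r a K : R) :
  0 < a ->
  (forall s, r <= s -> is_derive f s (df s)) ->
  (forall s, r <= s -> is_derive H s (dH s)) ->
  (forall s, r <= s -> df s <= - a * dH s) ->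
  (forall M, exists r2, r <= r2 /\ forall s, r2 <= s -> M <= H s) ->
  exists r2, r <= r2 /\ forall s, r2 <= s -> f s <= K.
Proof.
  intros Ha Hf HH Hle Hlim.
  destruct (Hlim ((f r + a * H r - K) / a)) as (r2 & Hr2 & Hlarge).
  exists r2. split; [exact Hr2|]. intros s Hs.
  assert (L : f s + a * H s <= f r + a * H r).
  { apply (nonincreasing_of_derive (fun s => f s + a * H s) (fun s => df s + a * dH s)).
    - lra.
    - intros x Hx. apply (is_derive_plus f (fun s => a * H s)); [apply Hf; lra|].
      apply is_derive_scal, HH; lra.
    - intros x Hx. assert (df x <= - a * dH x) by (apply Hle; lra). lra. }
  specialize (Hlarge s Hs). apply Rle_div_l in Hlarge; [|exact Ha]. lra.
Qed.

Lemma ln_large (r M : R) : exists r2, r <= r2 /\ forall s, r2 <= s -> M <= ln s.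
Proof.
  exists (Rmax r (exp M)). split; [apply Rmax_l|]. intros s Hs.
  rewrite <- (ln_exp M).
  apply ln_le; [apply exp_pos|]. apply Rle_trans with (2 := Hs), Rmax_r.
Qed.

Lemma ln_ge_1 (s : R) : 3 <= s -> 1 <= ln s.
Proof.
  intros Hs. rewrite <- (ln_exp 1). apply ln_le; [apply exp_pos|].
  pose proof exp_le_3. lra.
Qed.

Lemma is_derive_ln_pos (s : R) : 0 < s -> is_derive ln s (/ s).
Proof. intros Hs. auto_derive; [exact Hs|field; lra]. Qed.

Lemma eventually_le_log (f df : R -> R) (r a K : R) :
  0 < r -> 0 < a ->
  (forall s, r <= s -> is_derive f s (df s)) ->
  (forall s, r <= s -> df s <= - a * / s) ->
  exists r2, r <= r2 /\ forall s, r2 <= s -> f s <= K.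
Proof.
  intros Hr Ha Hf Hle.
  apply (eventually_le_of_derive f df ln Rinv r a); auto.
  - intros s Hs. apply is_derive_ln_pos; lra.
  - intros M. apply ln_large.
Qed.

Lemma eventually_le_loglog (f df : R -> R) (r a K : R) :
  3 <= r -> 0 < a ->
  (forall s, r <= s -> is_derive f s (df s)) ->
  (forall s, r <= s -> df s <= - a * / (s * ln s)) ->
  exists r2, r <= r2 /\ forall s, r2 <= s -> f s <= K.
Proof.
  intros Hr Ha Hf Hle.
  apply (eventually_le_of_derive f df (fun s => ln (ln s)) (fun s => / (s * ln s)) r a); auto.
  - intros s Hs. assert (1 <= ln s) by (apply ln_ge_1; lra).
    auto_derive; [split; lra|field; lra].
  - intros M. destruct (ln_large 3 M) as (r3 & Hr3 & H3).
    destruct (ln_large r r3) as (r2 & Hr2 & H2).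
    exists r2. split; auto.
Qed.

Lemma eventually_ge_sqr (f df : R -> R) (r c : R) :
  0 < r -> 0 < c ->
  (forall s, r <= s -> is_derive f s (df s)) ->
  (forall s, r <= s -> c * s <= df s) ->
  exists r2, r <= r2 /\ forall s, r2 <= s -> c / 4 * s ^ 2 <= f s.
Proof.
  intros Hr Hc Hf Hle.
  set (K := Rabs (f r - c / 2 * r ^ 2)).
  assert (HK : 0 <= K) by apply Rabs_pos.
  (* From here on [s ^ 2 >= 4 * K / c], so half of the leading term [c / 2 * s ^ 2] pays for the
     integration constant. *)
  exists (r + (1 + 4 * K / c)).
  assert (0 <= 4 * K / c) by (apply Rdiv_le_0_compat; lra).
  split; [lra|]. intros s Hs.
  assert (L : f r - c / 2 * r ^ 2 <= f s - c / 2 * s ^ 2).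
  { apply (nondecreasing_of_derive (fun s => f s - c / 2 * s ^ 2) (fun s => df s - c * s)).
    - lra.
    - intros x Hx. apply (is_derive_minus f (fun s => c / 2 * s ^ 2)); [apply Hf; lra|].
      auto_derive; [exact I|field].
    - intros x Hx. assert (c * x <= df x) by (apply Hle; lra). lra. }
  assert (- K <= f r - c / 2 * r ^ 2) by exact (proj1 (proj1 (Rabs_le_between _ _) (Rle_refl K))).
  assert (4 * K / c <= s ^ 2) by nra.
  assert (4 * K <= s ^ 2 * c) by (apply Rle_div_l; lra).
  lra.
Qed.

Lemma sqr_ln_increasing_bounds (s : R) : 3 <= s ->
  1 <= s ^ 2 * ln s /\ is_derive (fun s => s ^ 2 * ln s) s (2 * s * ln s + s).
Proof.
  intros Hs. pose proof (ln_ge_1 s Hs). split; [nra|].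
  auto_derive; [lra|field; lra].
Qed.

(** If [s * z1] were negative once, it would stay below a negative constant, which drives [z], then
    [s * u1], then [u] to minus infinity. Hence [z] is nondecreasing, and the alternative is whether
    it ever becomes positive: if so, [z] is bounded below by a positive constant and [u] grows at
    least quadratically; if not, [s * u1] is nonincreasing and, by the same argument,
    nonnegative. *)
Lemma radial_growth (u u1 z z1 b : R -> R) (r0 : R) :
  3 <= r0 ->
  (forall s, r0 < s -> is_derive u s (u1 s)) ->
  (forall s, r0 < s -> is_derive (fun s => s * u1 s) s (s * z s)) ->
  (forall s, r0 < s -> is_derive z s (z1 s)) ->
  (forall s, r0 < s -> is_derive (fun s => s * z1 s) s (s * b s)) ->
  (forall s, r0 < s -> b s <= 0) -> (forall s, r0 < s -> 0 < u s) ->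
  (forall s, r0 < s -> 0 <= s * z1 s) /\
  exists c C R, 0 < c /\ 0 <= C /\ r0 < R /\
    ((forall s, R <= s -> c * s ^ 2 <= u s <= C * (s ^ 2 * ln s)) \/
     (forall s, R <= s -> c <= u s <= C * ln s)).
Proof.
  intros Hr0 H1 H2 H3 H4 Hb Hu.
  assert (Dinv : forall s k x, 0 < s -> s * x <= - k -> x <= - k * / s).
  { intros s k x Hs Hx. apply Rmult_le_reg_l with s; [exact Hs|].
    replace (s * (- k * / s)) with (- k) by (field; lra). exact Hx. }
  assert (Flux_neg : forall r a, r0 < r -> 0 < a -> ~ forall s, r <= s -> s * u1 s <= - a).
  { intros r a Hr Ha Hneg.
    destruct (eventually_le_log u u1 r a 0) as (r2 & Hr2 & Hle); try lra.
    - intros s Hs. apply H1; lra.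
    - intros s Hs. apply Dinv; [lra|auto].
    - specialize (Hle r2 ltac:(lra)). specialize (Hu r2 ltac:(lra)). lra. }
  assert (Z_neg : forall r a, r0 < r -> 0 < a -> ~ forall s, r <= s -> z s <= - a).
  { intros r a Hr Ha Hneg.
    destruct (eventually_le_log (fun s => s * u1 s) (fun s => s * z s) r a (- 1))
      as (r2 & Hr2 & Hle); try lra.
    - intros s Hs. apply H2; lra.
    - intros s Hs. specialize (Hneg s Hs).
      (* The rate [- a * s] is weakened to [- a / s]; a logarithmic decrease is enough. *)
      assert (/ s <= s).
      { apply Rle_trans with 1; [|lra]. rewrite <- Rinv_1. apply Rinv_le_contravar; lra. }
      nra.
    - apply (Flux_neg r2 1); auto; lra. }
  assert (N2mono : forall r s, r0 < r -> r <= s -> s * z1 s <= r * z1 r).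
  { intros r s Hr Hs.
    apply (nonincreasing_of_derive (fun s => s * z1 s) (fun s => s * b s)); auto.
    - intros; apply H4; lra.
    - intros x Hx. assert (b x <= 0) by (apply Hb; lra). nra. }
  assert (N2pos : forall s, r0 < s -> 0 <= s * z1 s).
  { intros r Hr. apply Rnot_lt_le. intros Hneg.
    destruct (eventually_le_log z z1 r (- (r * z1 r)) (- 1)) as (r2 & Hr2 & Hle); try lra.
    - intros s Hs. apply H3; lra.
    - intros s Hs. apply Dinv; [lra|]. rewrite Ropp_involutive. now apply N2mono.
    - apply (Z_neg r2 1); auto; lra. }
  split; [exact N2pos|].
  assert (Zmono : forall r s, r0 < r -> r <= s -> z r <= z s).
  { intros r s Hr Hs. apply (nondecreasing_of_derive z z1); auto.
    - intros; apply H3; lra.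
    - intros x Hx. assert (0 <= x * z1 x) by (apply N2pos; lra). nra. }
  set (r1 := r0 + 1).
  destruct (classic (exists r, r0 < r /\ 0 < z r)) as [(r & Hr & Hz)|Hnz].
  - destruct (eventually_ge_sqr (fun s => s * u1 s) (fun s => s * z s) r (z r))
      as (r2 & Hr2 & L2); try lra.
    { intros; apply H2; lra. }
    { intros s Hs. specialize (Zmono r s Hr Hs). nra. }
    destruct (eventually_ge_sqr u u1 r2 (z r / 4)) as (r3 & Hr3 & L3); try lra.
    { intros; apply H1; lra. }
    { intros s Hs. apply Rmult_le_reg_l with s; [lra|]. specialize (L2 s Hs). simpl in L2. lra. }
    destruct (le_comparison_multiple z z1 ln Rinv r1 (r1 * z1 r1)) as (C1 & HC1 & U1).
    { apply N2pos; unfold r1; lra. }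
    { intros s Hs. apply H3; unfold r1 in Hs; lra. }
    { intros s Hs. apply is_derive_ln_pos; unfold r1 in Hs; lra. }
    { intros s Hs. apply Rmult_le_reg_l with s; [unfold r1 in Hs; lra|].
      replace (s * (r1 * z1 r1 * / s)) with (r1 * z1 r1) by (field; unfold r1 in Hs; lra).
      apply N2mono; unfold r1 in *; lra. }
    { intros s Hs. apply ln_ge_1; unfold r1 in Hs; lra. }
    (* The comparison function [s ^ 2 * ln s] serves twice: once it bounds [s * u1], [u1] is at most
       a multiple of [s * ln s], hence of its derivative. *)
    destruct (le_comparison_multiple (fun s => s * u1 s) (fun s => s * z s)
      (fun s => s ^ 2 * ln s) (fun s => 2 * s * ln s + s) r1 C1) as (C2 & HC2 & U2); auto.
    { intros s Hs. apply H2; unfold r1 in Hs; lra. }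
    { intros s Hs. apply sqr_ln_increasing_bounds; unfold r1 in Hs; lra. }
    { intros s Hs. specialize (U1 s Hs). unfold r1 in Hs.
      assert (1 <= ln s) by (apply ln_ge_1; lra).
      assert (s * z s <= s * (C1 * ln s)) by (apply Rmult_le_compat_l; lra).
      assert (0 <= C1 * (s * ln s + s)) by (apply Rmult_le_pos; [lra|nra]). nra. }
    { intros s Hs. apply sqr_ln_increasing_bounds; unfold r1 in Hs; lra. }
    destruct (le_comparison_multiple u u1
      (fun s => s ^ 2 * ln s) (fun s => 2 * s * ln s + s) r1 C2) as (C3 & HC3 & U3); auto.
    { intros s Hs. apply H1; unfold r1 in Hs; lra. }
    { intros s Hs. apply sqr_ln_increasing_bounds; unfold r1 in Hs; lra. }
    { intros s Hs. specialize (U2 s Hs). unfold r1 in Hs.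
      assert (1 <= ln s) by (apply ln_ge_1; lra).
      assert (0 <= C2 * (s * ln s + s)) by (apply Rmult_le_pos; [lra|nra]).
      apply Rmult_le_reg_l with s; [lra|]. simpl in U2. nra. }
    { intros s Hs. apply sqr_ln_increasing_bounds; unfold r1 in Hs; lra. }
    exists (z r / 4 / 4), C3, (Rmax r1 r3).
    pose proof (Rmax_l r1 r3). pose proof (Rmax_r r1 r3).
    split; [lra|]. split; [exact HC3|]. split; [unfold r1 in *; lra|].
    left. intros s Hs. split; [apply L3|apply U3]; lra.
  - assert (Znp : forall s, r0 < s -> z s <= 0).
    { intros s Hs. apply Rnot_lt_le. intros Hz. apply Hnz. now exists s. }
    assert (N1mono : forall r s, r0 < r -> r <= s -> s * u1 s <= r * u1 r).
    { intros r s Hr Hs.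
      apply (nonincreasing_of_derive (fun s => s * u1 s) (fun s => s * z s)); auto.
      - intros; apply H2; lra.
      - intros x Hx. assert (z x <= 0) by (apply Znp; lra). nra. }
    assert (N1pos : forall s, r0 < s -> 0 <= s * u1 s).
    { intros r Hr. apply Rnot_lt_le. intros Hneg.
      apply (Flux_neg r (- (r * u1 r))); [exact Hr|lra|].
      intros s Hs. rewrite Ropp_involutive. now apply N1mono. }
    destruct (le_comparison_multiple u u1 ln Rinv r1 (r1 * u1 r1)) as (C & HC & U).
    { apply N1pos; unfold r1; lra. }
    { intros s Hs. apply H1; unfold r1 in Hs; lra. }
    { intros s Hs. apply is_derive_ln_pos; unfold r1 in Hs; lra. }
    { intros s Hs. apply Rmult_le_reg_l with s; [unfold r1 in Hs; lra|].
      replace (s * (r1 * u1 r1 * / s)) with (r1 * u1 r1) by (field; unfold r1 in Hs; lra).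
      apply N1mono; unfold r1 in *; lra. }
    { intros s Hs. apply ln_ge_1; unfold r1 in Hs; lra. }
    exists (u r1), C, r1.
    split; [apply Hu; unfold r1; lra|]. split; [exact HC|]. split; [unfold r1; lra|].
    right. intros s Hs. split; [|now apply U].
    apply (nondecreasing_of_derive u u1); auto.
    + intros x Hx. apply H1; unfold r1 in Hx; lra.
    + intros x Hx. unfold r1 in Hx. assert (0 <= x * u1 x) by (apply N1pos; lra). nra.
Qed.

(** * The nonlinearity and the domain *)

Lemma ln_div_nonincreasing (s t : R) : 3 <= s -> s <= t -> ln t / t <= ln s / s.
Proof.
  intros Hs Hst.
  apply (nonincreasing_of_derive (fun s => ln s / s) (fun s => (1 - ln s) / s ^ 2)); auto.
  - intros x Hx. auto_derive; [repeat split; lra|field; lra].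
  - intros x Hx. pose proof (ln_ge_1 x ltac:(lra)).
    assert (0 < / x ^ 2) by (apply Rinv_0_lt_compat, pow_lt; lra).
    unfold Rdiv. nra.
Qed.

Lemma LimInf_p_infty_pos (g : R -> R) :
  Rbar_lt 0 (LimInf_p_infty g) ->
  exists c M, 0 < c /\ forall s, M < s -> c <= g s.
Proof.
  intros Hg. apply NNPP. intros Hno.
  apply (Rbar_lt_not_le _ _ Hg). unfold LimInf_p_infty.
  unfold Rbar_lub. destruct (Rbar_ex_lub _) as [sup Hsup]; simpl. apply Hsup. intros L (M & ->).
  apply Rbar_not_lt_le. intros Hpos. apply Hno.
  destruct (Glb_Rbar_correct (fun y => exists s, M < s /\ y = g s)) as [Hlb _].
  set (l := Glb_Rbar _) in *.
  assert (Hl : forall s, M < s -> Rbar_le l (g s)) by (intros s Hs; apply Hlb; now exists s).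
  clearbody l. destruct l as [l| |]; simpl in Hpos; [| |contradiction].
  - now exists l, M.
  (* An infinite infimum is absurd, since [g s] is a real number for every [s > M]. *)
  - exists 1, M. split; [lra|]. intros s Hs. contradiction (Hl s Hs).
Qed.

(** For large [s] the liminf gives a multiple of [ln s / s], which is at least the same multiple of
    [ln S / S] by monotonicity. On the remaining compact interval [f] has a positive minimum, and
    [ln S / S <= 1]. *)
Lemma lower_bound_up_to (f : R -> R) (eps : R) :
  (forall s, 0 < s -> 0 < f s) -> (forall s, 0 < s -> continuous f s) ->
  Rbar_lt 0 (LimInf_p_infty (fun s => f s / (/ s * ln s))) ->
  0 < eps ->
  exists c, 0 < c /\ forall S s, eps <= s <= S -> 3 <= S -> c * (ln S / S) <= f s.
Proof.
  intros Hpos Hcont Hlim Heps.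
  destruct (LimInf_p_infty_pos _ Hlim) as (c & M & Hc & HM).
  set (M1 := Rmax 3 (M + 1)).
  pose proof (Rmax_l 3 (M + 1) : 3 <= M1). pose proof (Rmax_r 3 (M + 1) : M + 1 <= M1).
  (* The minimum with [M1] keeps the interval nonempty when [eps > M1]. *)
  set (a := Rmin eps M1).
  assert (Ha : 0 < a) by (apply Rmin_pos; lra).
  destruct (continuity_ab_min f a M1) as (m & Hm & Hma).
  { apply Rmin_r. }
  { intros s Hs. apply continuity_pt_filterlim, Hcont; lra. }
  assert (Hfm : 0 < f m) by (apply Hpos; lra).
  exists (Rmin c (f m)). split; [now apply Rmin_pos|].
  intros S s Hs HS.
  assert (HlnS : 0 <= ln S / S <= 1).
  { pose proof (ln_ge_1 S HS). split; [apply Rdiv_le_0_compat; lra|].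
    apply Rle_div_l; [lra|]. pose proof (exp_ineq1 (ln S)).
    rewrite exp_ln in *; lra. }
  destruct (Rle_lt_dec s M1) as [Hle|Hlt].
  - apply Rle_trans with (f m).
    + apply Rle_trans with (f m * (ln S / S)); [|nra].
      apply Rmult_le_compat_r; [lra|apply Rmin_r].
    + apply Hm. split; [|exact Hle]. apply Rle_trans with (2 := proj1 Hs), Rmin_l.
  - assert (Hs1 : c <= f s / (/ s * ln s)) by (apply HM; lra).
    assert (1 <= ln s) by (apply ln_ge_1; lra).
    assert (0 < / s) by (apply Rinv_0_lt_compat; lra).
    apply Rle_div_r in Hs1; [|nra].
    apply Rle_trans with (c * (ln S / S)).
    { apply Rmult_le_compat_r; [lra|apply Rmin_l]. }
    apply Rle_trans with (2 := Hs1).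
    apply Rmult_le_compat_l; [lra|]. rewrite (Rmult_comm (/ s)).
    apply ln_div_nonincreasing; lra.
Qed.

Lemma compact_set_bounded (K : R * R -> Prop) :
  compact_set K ->
  exists r, forall x y, K (x, y) -> Rabs x < r /\ Rabs y < r.
Proof.
  intros HK.
  destruct (HK nat (fun n p => Rabs (fst p) < INR n /\ Rabs (snd p) < INR n)) as [l Hl].
  - intros n. apply (open_and (T := prod_UniformSpace R_UniformSpace R_UniformSpace)).
    + apply (open_comp (fun p : R * R => Rabs (fst p)) (fun t => t < INR n)); [|apply open_lt].
      intros p _. apply (continuous_comp fst Rabs); [|apply continuous_Rabs].
      destruct p. apply continuous_fst.
    + apply (open_comp (fun p : R * R => Rabs (snd p)) (fun t => t < INR n)); [|apply open_lt].
      intros p _. apply (continuous_comp snd Rabs); [|apply continuous_Rabs].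
      destruct p. apply continuous_snd.
  - intros [x y] _. simpl.
    destruct (INR_unbounded (Rmax (Rabs x) (Rabs y))) as [n Hn].
    exists n. pose proof (Rmax_l (Rabs x) (Rabs y)). pose proof (Rmax_r (Rabs x) (Rabs y)). lra.
  - exists (INR (list_max l)). intros x y Hxy.
    destruct (Hl (x, y) Hxy) as (n & Hn & Hx & Hy). simpl in Hx, Hy.
    assert (INR n <= INR (list_max l)).
    { apply le_INR. pose proof (proj1 (list_max_le l (list_max l)) (Nat.le_refl _)) as Hall.
      rewrite Forall_forall in Hall. now apply Hall. }
    lra.
Qed.

Lemma exterior_domain_outside (Omega : R * R -> Prop) :
  exterior_domain Omega ->
  exists r0, 3 <= r0 /\ forall x y, outside r0 x y -> Omega (x, y).
Proof.
  intros (K & HK & HOmega).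
  destruct (compact_set_bounded K HK) as [r Hr].
  (* The square [|x|, |y| < r] lies in the disc of radius [2 * r]; radii from 3 on satisfy
     [ln s >= 1]. *)
  exists (Rmax 3 (2 * r)). split; [apply Rmax_l|].
  intros x y Hxy. apply HOmega. intros HKxy.
  destruct (Hr x y HKxy) as [Hx Hy].
  pose proof (Rmax_r 3 (2 * r)). unfold outside in Hxy.
  rewrite <- (pow2_abs x), <- (pow2_abs y) in Hxy.
  pose proof (Rabs_pos x). pose proof (Rabs_pos y). nra.
Qed.

(** * From [C^4] regularity to the two Laplacians *)

Lemma ex_diff_n_grad_on U g n :
  (forall x y, U x y -> ex_diff_n g (S n) x y) ->
  let gx := fun x y => Derive (fun t => g t y) x in
  let gy := fun x y => Derive (fun t => g x t) y in
  grad_on U g gx gy /\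
  (forall x y, U x y -> ex_diff_n gx n x y) /\ (forall x y, U x y -> ex_diff_n gy n x y).
Proof.
  intros Hg gx gy.
  assert (Hc : forall h m x y, ex_diff_n h m x y -> continuity_2d_pt h x y)
    by (intros h [|m] x y H; apply H).
  split; [|split].
  - intros x y Hxy. destruct (Hg x y Hxy) as (_ & Ex & Ey & Dx & Dy).
    split; [|split; [|split]].
    + now apply Derive_correct.
    + now apply Derive_correct.
    + exact (Hc gx n x y Dx).
    + exact (Hc gy n x y Dy).
  - intros x y Hxy. apply (Hg x y Hxy).
  - intros x y Hxy. apply (Hg x y Hxy).
Qed.

Lemma grad_on_plus U g gx gy h hx hy :
  grad_on U g gx gy -> grad_on U h hx hy ->
  grad_on U (fun x y => g x y + h x y) (fun x y => gx x y + hx x y)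
    (fun x y => gy x y + hy x y).
Proof.
  intros Hg Hh x y Hxy.
  destruct (Hg x y Hxy) as (? & ? & ? & ?), (Hh x y Hxy) as (? & ? & ? & ?).
  split; [|split; [|split]].
  - now apply (is_derive_plus (fun t => g t y) (fun t => h t y)).
  - now apply (is_derive_plus (fun t => g x t) (fun t => h x t)).
  - now cont2d.
  - now cont2d.
Qed.

Lemma lap_on_laplacian U g h x y :
  open_2d U -> lap_on U g h -> U x y -> laplacian g x y = h x y.
Proof.
  intros HU (gx & gy & gxx & gxy & gyx & gyy & H1 & H2 & H3 & H4) Hxy.
  rewrite H4 by exact Hxy. unfold laplacian, partial_derive. simpl. f_equal.
  - rewrite <- (is_derive_unique _ _ _ (proj1 (H2 x y Hxy))).
    apply Derive_ext_loc.
    apply (locally_2d_1d_const_y (fun t z => Derive (fun t => g t z) t = gx t z)).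
    apply locally_2d_impl with (2 := HU x y Hxy), locally_2d_forall.
    intros u w Huw. now apply is_derive_unique, H1.
  - rewrite <- (is_derive_unique _ _ _ (proj1 (proj2 (H3 x y Hxy)))).
    apply Derive_ext_loc.
    apply (locally_2d_1d_const_x (fun t z => Derive (fun z => g t z) z = gy t z)).
    apply locally_2d_impl with (2 := HU x y Hxy), locally_2d_forall.
    intros u w Huw. now apply is_derive_unique, H1.
Qed.

Lemma C4_lap_on U v :
  open_2d U -> (forall x y, U x y -> ex_diff_n v 4 x y) ->
  lap_on U v (laplacian v) /\ lap_on U (laplacian v) (bilaplacian v).
Proof.
  intros HU Hv.
  destruct (ex_diff_n_grad_on U v 3 Hv) as (G & Hx & Hy).
  set (vx := fun x y => Derive (fun t => v t y) x) in *.
  set (vy := fun x y => Derive (fun t => v x t) y) in *.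
  destruct (ex_diff_n_grad_on U vx 2 Hx) as (Gx & Hxx & _).
  destruct (ex_diff_n_grad_on U vy 2 Hy) as (Gy & _ & Hyy).
  set (vxx := fun x y => Derive (fun t => vx t y) x) in *.
  set (vyy := fun x y => Derive (fun t => vy x t) y) in *.
  destruct (ex_diff_n_grad_on U vxx 1 Hxx) as (Ga & Hax & Hay).
  destruct (ex_diff_n_grad_on U vyy 1 Hyy) as (Gb & Hbx & Hby).
  pose proof (proj1 (ex_diff_n_grad_on U _ 0 Hax)) as Gax.
  pose proof (proj1 (ex_diff_n_grad_on U _ 0 Hay)) as Gay.
  pose proof (proj1 (ex_diff_n_grad_on U _ 0 Hbx)) as Gbx.
  pose proof (proj1 (ex_diff_n_grad_on U _ 0 Hby)) as Gby.
  split.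
  - do 6 eexists. split; [exact G|]. split; [exact Gx|]. split; [exact Gy|].
    reflexivity.
  (* The construction yields a sum of fourth derivatives, whereas [bilaplacian] differentiates the
     sum [laplacian v]; [lap_on_laplacian] identifies the two on [U]. *)
  - assert (L : exists h, lap_on U (laplacian v) h).
    { eexists. do 6 eexists.
      split; [exact (grad_on_plus _ _ _ _ _ _ _ Ga Gb)|].
      split; [exact (grad_on_plus _ _ _ _ _ _ _ Gax Gbx)|].
      split; [exact (grad_on_plus _ _ _ _ _ _ _ Gay Gby)|].
      intros x y _. apply eq_refl. }
    destruct L as [h L]. pose proof L as (wx & wy & wxx & wxy & wyx & wyy & L1 & L2 & L3 & L4).
    exists wx, wy, wxx, wxy, wyx, wyy. split; [exact L1|]. split; [exact L2|]. split; [exact L3|].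
    intros x y Hxy. rewrite <- L4 by exact Hxy. now apply (lap_on_laplacian U).
Qed.

(** * The averaged inequality and the contradiction *)

(** Treats both growth rates at once. The condition [A s * ln s <= s ^ 2 * ln (C * A s * ln s)] is
    precisely what turns the averaged right-hand side into a multiple of [1 / (s ln s)]. *)
Lemma radial_contradiction f v b psi r0 T c C (A : R -> R) :
  (forall s, 0 < s -> 0 < f s) -> (forall s, 0 < s -> continuous f s) ->
  Rbar_lt 0 (LimInf_p_infty (fun s => f s / (/ s * ln s))) ->
  (forall x y, outside r0 x y ->
     0 < v x y /\ b x y <= - f (v x y) /\
     continuity_2d_pt v x y /\ continuity_2d_pt b x y) ->
  (forall s, r0 < s -> is_derive (fun s => s * psi s) s (s * mean b 0 0 s)) ->
  (forall s, r0 < s -> 0 <= s * psi s) ->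
  0 < c -> 0 < C -> 3 <= r0 -> r0 < T ->
  (forall s, T <= s -> 1 <= A s /\ c * A s <= mean v 0 0 s /\
     3 <= C * A s * ln s /\ A s * ln s <= s ^ 2 * ln (C * A s * ln s)) ->
  (forall s x y, T <= s -> x ^ 2 + y ^ 2 = s ^ 2 -> v x y <= C * A s * ln s) ->
  False.
Proof.
  intros f_pos f_cont f_liminf Hv Hpsi Hpos Hc HC Hr0 HT HA Hsup.
  assert (HPI := PI_RGT_0).
  (* Then [2 * PI * eps = c / 2]: since [A s >= 1], subtracting [eps] from [v] costs at most half of
     the lower bound [c * A s] of its mean. *)
  set (eps := c / (4 * PI)).
  assert (Heps : 0 < eps) by (apply Rdiv_lt_0_compat; lra).
  destruct (lower_bound_up_to f eps f_pos f_cont f_liminf Heps) as (c0 & Hc0 & Hf).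
  destruct (eventually_le_loglog (fun s => s * psi s) (fun s => s * mean b 0 0 s)
    T (c0 * c / (2 * C ^ 2)) (- 1)) as (R2 & HR2 & Hle).
  - lra.
  - apply Rdiv_lt_0_compat; nra.
  - intros s Hs. apply Hpsi; lra.
  - intros s Hs. destruct (HA s Hs) as (HA1 & HAu & HS3 & HAS).
    set (S := C * A s * ln s) in *.
    pose proof (ln_ge_1 s ltac:(lra)) as Hln.
    pose proof (ln_ge_1 S HS3) as HlnS.
    assert (Hcirc : forall t, outside r0 (0 + s * cos t) (0 + s * sin t)).
    { intros t. unfold outside. rewrite circle_dist. nra. }
    set (kappa := c0 * (ln S / S) / S).
    assert (HkS : 0 < c0 * (ln S / S)).
    { apply Rmult_lt_0_compat; [exact Hc0|]. apply Rdiv_lt_0_compat; lra. }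
    assert (Hkappa : 0 < kappa) by (apply Rdiv_lt_0_compat; lra).
    assert (Hmean : mean b 0 0 s <= - kappa * (mean v 0 0 s - 2 * PI * eps)).
    { replace (- kappa * (mean v 0 0 s - 2 * PI * eps))
        with (mean (fun x y => - kappa * (v x y - eps)) 0 0 s).
      - apply (mean_le (outside r0)).
        + intros x y Hxy. apply (Hv x y Hxy).
        + intros x y Hxy. destruct (Hv x y Hxy) as (_ & _ & Cv & _).
          unfold Rminus. now cont2d.
        + exact Hcirc.
        + intros t. destruct (Hv _ _ (Hcirc t)) as (V0 & Vb & _ & _).
          assert (VS : v (0 + s * cos t) (0 + s * sin t) <= S).
          { apply Hsup; [exact Hs|]. rewrite circle_dist. ring. }
          set (V := v _ _) in *. specialize (f_pos V V0).
          (* For [V < eps] the linear function is positive on the right-hand side, while [b] is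
             negative. Otherwise [V - eps <= S] and [kappa * S] is the lower bound of [f]. *)
          destruct (Rle_lt_dec eps V) as [HV|HV]; [|nra].
          specialize (Hf S V (conj HV VS) HS3).
          assert (kappa * (V - eps) <= kappa * S) by (apply Rmult_le_compat_l; lra).
          replace (kappa * S) with (c0 * (ln S / S)) in * by (unfold kappa; field; lra).
          lra.
      - rewrite <- mean_const with (x0 := 0) (y0 := 0) (s := s).
        unfold mean.
        assert (Iv := ex_RInt_polar v 0 0 s 0 (2 * PI)
          (fun t => proj1 (proj2 (proj2 (Hv _ _ (Hcirc t)))))).
        rewrite <- (RInt_minus (V := R_CompleteNormedModule)
          (fun t => v (0 + s * cos t) (0 + s * sin t)) (fun _ => eps));
          [|exact Iv|apply ex_RInt_const].
        apply (RInt_scal (V := R_CompleteNormedModule)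
          (fun t => v (0 + s * cos t) (0 + s * sin t) - eps)).
        apply (ex_RInt_minus (V := R_NormedModule)
          (fun t => v (0 + s * cos t) (0 + s * sin t)) (fun _ => eps));
          [exact Iv|apply ex_RInt_const]. }
    assert (HA2 : c * A s / 2 <= mean v 0 0 s - 2 * PI * eps).
    { replace (2 * PI * eps) with (c / 2) by (unfold eps; field; lra). nra. }
    assert (Hmean2 : s * mean b 0 0 s <= - (s * (kappa * (c * A s / 2)))).
    { assert (kappa * (c * A s / 2) <= kappa * (mean v 0 0 s - 2 * PI * eps))
        by (apply Rmult_le_compat_l; lra).
      nra. }
    apply Rle_trans with (1 := Hmean2).
    assert (Hfrac : / (s * ln s) <= s * ln S / (A s * ln s ^ 2)).
    { apply Rle_div_r; [apply Rmult_lt_0_compat; [lra|apply pow_lt; lra]|].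
      replace (/ (s * ln s) * (A s * ln s ^ 2)) with (A s * ln s / s) by (field; lra).
      apply Rle_div_l; [lra|]. simpl in HAS |- *. lra. }
    replace (s * (kappa * (c * A s / 2)))
      with (c0 * c / (2 * C ^ 2) * (s * ln S / (A s * ln s ^ 2))).
    2: { unfold kappa. set (l := ln S). unfold S. field. lra. }
    rewrite <- Ropp_mult_distr_l. apply Ropp_le_contravar, Rmult_le_compat_l; [|exact Hfrac].
    apply Rdiv_le_0_compat; nra.
  - specialize (Hle R2 ltac:(lra)). specialize (Hpos R2 ltac:(lra)). lra.
Qed.

Lemma ln_le_twice (s t : R) : 3 <= s -> 0 < t <= 3 * s / 2 -> ln t <= 2 * ln s.
Proof.
  intros Hs Ht. replace (2 * ln s) with (ln (s * s)) by (rewrite ln_mult; lra).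
  apply ln_le; nra.
Qed.

Theorem theorem1p4 (f : R -> R)
  (f_pos : forall s : R, 0 < s -> 0 < f s)
  (f_cont : forall s : R, 0 < s -> continuous f s)
  (f_liminf : Rbar_lt 0 (LimInf_p_infty (fun s => f s / (/ s * ln s)))) :
  forall Omega : R * R -> Prop, exterior_domain Omega ->
    ~ exists v : R -> R -> R, C4_positive_solution f Omega v.
Proof.
  intros Omega HOmega (v & HC4 & Hpos & Hineq).
  destruct (exterior_domain_outside Omega HOmega) as (r0 & Hr0 & Hout).
  set (U := outside r0) in *.
  pose proof (open_outside r0 : open_2d U) as HU.
  destruct (C4_lap_on U v HU) as [Lv Lw].
  { intros x y Hxy. now apply HC4, Hout. }
  set (w := laplacian v) in *. set (b := bilaplacian v) in *.
  assert (Hb : forall x y, U x y -> b x y <= - f (v x y)).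
  { intros x y Hxy. specialize (Hineq x y (Hout x y Hxy)). fold b in Hineq. lra. }
  assert (Hvpos : forall x y, U x y -> 0 < v x y) by auto.
  assert (Hbneg : forall x y, U x y -> b x y <= 0).
  { intros x y Hxy. pose proof (f_pos _ (Hvpos x y Hxy)). specialize (Hb x y Hxy). lra. }
  assert (Hcirc : forall s t, r0 < s -> U (0 + s * cos t) (0 + s * sin t)).
  { intros s t Hs. unfold U, outside. rewrite circle_dist. nra. }
  destruct (lap_on_mean U v w 0 0 HU Lv) as [phi Hphi].
  destruct (lap_on_mean U w b 0 0 HU Lw) as [psi Hpsi].
  assert (Hphi' : forall s, r0 < s -> is_derive (mean v 0 0) s (phi s) /\
     is_derive (fun s => s * phi s) s (s * mean w 0 0 s)).
  { intros s Hs. apply (Hphi r0 (s + 1)); [|lra]. intros u t Hu. apply Hcirc; lra. }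
  assert (Hpsi' : forall s, r0 < s -> is_derive (mean w 0 0) s (psi s) /\
     is_derive (fun s => s * psi s) s (s * mean b 0 0 s)).
  { intros s Hs. apply (Hpsi r0 (s + 1)); [|lra]. intros u t Hu. apply Hcirc; lra. }
  assert (Cv : forall x y, U x y -> continuity_2d_pt v x y)
    by (intros x y Hxy; now apply (lap_on_continuity U v w)).
  assert (Cb : forall x y, U x y -> continuity_2d_pt b x y)
    by (intros x y Hxy; now apply (lap_on_continuity U w b)).
  destruct (radial_growth (mean v 0 0) phi (mean w 0 0) psi (mean b 0 0) r0 Hr0)
    as (Hflux & c & C & R & Hc & HC & HR & Hgrowth).
  - intros s Hs. now apply Hphi'.
  - intros s Hs. now apply Hphi'.
  - intros s Hs. now apply Hpsi'.
  - intros s Hs. now apply Hpsi'.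
  - intros s Hs.
    apply Rle_trans with (mean (fun _ _ => 0) 0 0 s); [|rewrite mean_const; lra].
    apply (mean_le U); auto. intros; apply continuity_2d_pt_const.
  - intros s Hs. apply (RInt_gt_0 (fun t => v (0 + s * cos t) (0 + s * sin t))).
    + pose proof PI_RGT_0. lra.
    + auto.
    + intros t _. apply (continuity_2d_pt_snd (fun s t => v (0 + s * cos t) (0 + s * sin t))).
      apply continuity_2d_polar; auto.
  (* [s >= 4 * R] gives [s > 4 * r0] and puts all radii from [s / 2] on in the range of
     [Hgrowth]. *)
  - assert (Hsup : forall s x y B, 4 * R <= s -> x ^ 2 + y ^ 2 = s ^ 2 ->
        (forall t, s / 2 <= t <= 3 * s / 2 -> mean v 0 0 t <= B) -> v x y <= 400 * B).
    { intros s x y B Hs Hxy. apply (pointwise_le_mean r0 v w b x y s); auto; lra. }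
    destruct Hgrowth as [Hgrowth|Hgrowth].
    (* [1800 = 400 * 9 / 4 * 2], from [t <= 3 * s / 2] and [ln t <= 2 * ln s]. The [+ 1] covers
       [C = 0] and ensures that the pointwise bound is at least [s]. *)
    + apply (radial_contradiction f v b psi r0 (4 * R) c (1800 * C + 1) (fun s => s ^ 2));
        auto; try lra.
      * intros s Hs. now apply Hpsi'.
      * intros s Hs. pose proof (ln_ge_1 s ltac:(lra)).
        assert (s <= (1800 * C + 1) * s ^ 2 * ln s).
        { assert (0 <= 1800 * C * (s ^ 2 * ln s)) by (apply Rmult_le_pos; nra). nra. }
        split; [nra|]. split; [apply Hgrowth; lra|]. split; [lra|].
        apply Rmult_le_compat_l; [nra|]. apply ln_le; lra.
      * intros s x y Hs Hxy. pose proof (ln_ge_1 s ltac:(lra)).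
        apply Rle_trans with (400 * (C * (9 / 4 * s ^ 2 * (2 * ln s)))); [|nra].
        apply (Hsup s); auto. intros t Ht.
        apply Rle_trans with (C * (t ^ 2 * ln t)); [apply Hgrowth; lra|].
        apply Rmult_le_compat_l; [exact HC|].
        pose proof (ln_ge_1 t ltac:(lra)).
        apply Rmult_le_compat; [nra|lra|nra|apply ln_le_twice; lra].
    (* [800 = 400 * 2], and the [+ 3] makes the pointwise bound at least 3. The last condition on
       [A] holds with room to spare, since [ln s <= s]. *)
    + apply (radial_contradiction f v b psi r0 (4 * R) c (800 * C + 3) (fun _ => 1));
        auto; try lra.
      * intros s Hs. now apply Hpsi'.
      * intros s Hs. pose proof (ln_ge_1 s ltac:(lra)).
        assert (HS : 3 <= (800 * C + 3) * 1 * ln s) by nra.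
        pose proof (ln_ge_1 _ HS).
        assert (ln s <= s).
        { pose proof (exp_ineq1 (ln s)). rewrite exp_ln in *; lra. }
        split; [lra|]. split; [rewrite Rmult_1_r; apply Hgrowth; lra|]. split; [exact HS|].
        nra.
      * intros s x y Hs Hxy. pose proof (ln_ge_1 s ltac:(lra)).
        apply Rle_trans with (400 * (C * (2 * ln s))); [|nra].
        apply (Hsup s); auto. intros t Ht.
        apply Rle_trans with (C * ln t); [apply Hgrowth; lra|].
        apply Rmult_le_compat_l; [exact HC|]. apply ln_le_twice; lra.
Qed.
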